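(* Let $\mathcal{A}$ and $\mathcal{B}$ be von Neumann algebras and let $S\colon \mathcal{A}\rightarrow\mathcal{B}$ be a normal unital completely positive map. Then there exist a Hilbert space $K$, a unit vector $k_0\in K$ and a normal (not necessarily unital) $*$-homomorphism $j\colon\mathcal{A}\rightarrow\mathcal{B}\otimes\mathscr{B}(K)$ such that, with the vector state $\psi=\langle k_0,\bullet\, k_0\rangle$ on $\mathscr{B}(K)$, $$S = P_\psi\circ j .$$ That is, $S$ admits a weak tensor dilation $j\colon \mathcal{A}\rightarrow\mathcal{B}\otimes\mathscr{B}(K)$ with a vector state $\psi$ given by some $k_0\in K$.
   Context: $\mathscr{B}(K)$ denotes the bounded operators on the Hilbert space $K$. The tensor product $\mathcal{B}\otimes\mathcal{C}$ of von Neumann algebras is the von Neumann algebra tensor product. Von Neumann algebras are taken as concrete strongly closed algebras acting non-degenerately on a Hilbert space. For a normal state $\psi$ on a von Neumann algebra $\mathcal{C}$, $P_\psi=\mathrm{id}_{\mathcal{B}}\otimes\psi\colon\mathcal{B}\otimes\mathcal{C}\rightarrow\mathcal{B}$ is the (normal) conditional expectation determined by $P_\psi(b\otimes c)=b\,\psi(c)$. Weak tensor dilation: given von Neumann algebras $\mathcal{A},\mathcal{B},\mathcal{C}$ and a normal (unital) completely positive map $S\colon\mathcal{A}\to\mathcal{B}$, a normal homomorphism $j\colon\mathcal{A}\to\mathcal{B}\otimes\mathcal{C}$ (not necessarily unital; homomorphism means $*$-homomorphism) is a weak tensor dilation of $S$ if there is a normal state $\psi$ on $\mathcal{C}$ such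 that $S=P_\psi\circ j$. *)

(* Defs.v *)
From HB Require Import structures.
From mathcomp Require Import all_boot all_order all_algebra sesquilinear.
From mathcomp Require Import complex.
From mathcomp Require Import all_classical all_reals all_analysis.

Set Implicit Arguments.
Unset Strict Implicit.
Unset Printing Implicit Defensive.

Import Order.TTheory GRing.Theory Num.Theory.
Import numFieldNormedType.Exports.

Local Open Scope classical_set_scope.
Local Open Scope ring_scope.

(* Complex Hilbert spaces. As for every form of type {dot _ for _}, the inner
   product is linear in its first argument and conjugate linear in its second
   one: the inner product <u, v> that is linear in v is dotp v u. *)
HB.mixin Record NormedModule_hasDot (R : realType) (H : Type)
    of NormedModule R[i] H := {
  dotp : {dot H for @Num.conj R[i]} ;
  dotp_norm : forall u : H, `|u| ^+ 2 = dotp u u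
}.

#[short(type="hilbertType")]
HB.structure Definition Hilbert (R : realType) :=
  {H of CompleteNormedModule R[i] H & NormedModule_hasDot R H}.

Section Span.
Context {R : realType} {V : lmodType R[i]}.

Definition lin_span (E : set V) : set V :=
  [set v | exists (n : nat) (a : 'I_n -> R[i]) (e : 'I_n -> V),
     (forall i, E (e i)) /\ v = \sum_(i < n) a i *: e i].

End Span.

Section Operators.
Context {R : realType} {H : hilbertType R}.
Implicit Types (x y : H -> H) (M : set (H -> H)).

Definition bounded_op : set (H -> H) :=
  [set x | linear x /\ continuous x].

(* By the Riesz representation theorem, every bounded operator x has exactly
   one adjoint y. *)
Definition is_adjoint x y := forall u v : H, dotp (x u) v = dotp u (y v).

Definition selfadjoint x := is_adjoint x x.

Definition positive_op x := forall u : H, 0 <= dotp (x u) u.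

Definition op_le x y := positive_op (y - x).

(* The operator on the direct sum of n copies of H with the matrix x is
   positive. *)
Definition positive_mx (n : nat) (x : 'I_n -> 'I_n -> H -> H) :=
  forall u : 'I_n -> H, 0 <= \sum_(i < n) \sum_(j < n) dotp (x i j (u j)) (u i).

(* The strong operator topology is the topology of pointwise convergence. *)
Definition strong_closure M : set (H -> H) :=
  bounded_op `&` closure (M : set {ptws H -> H}).

Definition nondegenerate M :=
  closure (lin_span [set v : H | exists x u, M x /\ v = x u]) = setT.

Record von_neumann_algebra M : Prop := VonNeumannAlgebra {
  vna_bounded : M `<=` bounded_op ;
  vna_zero : M 0 ;
  vna_linear : forall (a : R[i]) x y, M x -> M y -> M (a *: x + y) ;
  vna_comp : forall x y, M x -> M y -> M (x \o y) ;
  vna_adjoint : forall x y, M x -> bounded_op y -> is_adjoint x y -> M y ;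
  vna_closed : strong_closure M = M ;
  vna_nondegenerate : nondegenerate M
}.

End Operators.

Definition lub_in (T : Type) (le : T -> T -> Prop) (M D : set T) (x : T) :=
  [/\ M x, (forall d, D d -> le d x) &
      forall y, M y -> (forall d, D d -> le d y) -> le x y].

Definition directed (T : Type) (le : T -> T -> Prop) (D : set T) :=
  D !=set0 /\
  forall d e, D d -> D e -> exists f, [/\ D f, le d f & le e f].

(* In this section a map defined on a von Neumann algebra A is a function on
   all of H -> H, of which only the values on A are relevant. *)
Section Maps.
Context {R : realType} {H : hilbertType R}.
Variable A : set (H -> H).

Definition linear_on (V : lmodType R[i]) (f : (H -> H) -> V) :=
  forall (a : R[i]) x y, A x -> A y -> f (a *: x + y) = a *: f x + f y.

(* f preserves the suprema of bounded directed sets of selfadjoint elements *)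
Definition normal_on (T : Type) (le : T -> T -> Prop) (N : set T)
    (f : (H -> H) -> T) :=
  forall (D : set (H -> H)) x,
    D `<=` A `&` selfadjoint -> directed op_le D -> lub_in op_le A D x ->
    lub_in le N (f @` D) (f x).

Definition normal_state (psi : (H -> H) -> R[i]) :=
  [/\ linear_on (psi : _ -> R[i]^o),
      (forall x, A x -> positive_op x -> 0 <= psi x),
      psi idfun = 1 &
      normal_on (fun a b : R[i] => a <= b) setT psi].

Context {G : hilbertType R}.
Variable B : set (G -> G).
Implicit Type f : (H -> H) -> (G -> G).

Definition completely_positive f :=
  forall (n : nat) (x : 'I_n -> 'I_n -> H -> H),
    (forall i j, A (x i j)) -> positive_mx x ->
    positive_mx (fun i j => f (x i j)).

Definition normal_ucp f :=
  [/\ forall x, A x -> B (f x), linear_on f, completely_positive f,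
      f idfun = idfun & normal_on op_le B f].

Record normal_star_hom f : Prop := NormalStarHom {
  nsh_range : forall x, A x -> B (f x) ;
  nsh_linear : linear_on f ;
  nsh_comp : forall x y, A x -> A y -> f (x \o y) = f x \o f y ;
  nsh_adjoint : forall x y, A x -> A y -> is_adjoint x y ->
    is_adjoint (f x) (f y) ;
  nsh_normal : normal_on op_le B f
}.

End Maps.

(* The Hilbert space tensor product of H and K, given up to a unique unitary by
   a bilinear map with total range and <u (x) k, v (x) l> = <u, v> <k, l>. *)
Record hilbert_tensor (R : realType) (H K : hilbertType R) := HilbertTensor {
  tensor_space :> hilbertType R ;
  tensor : {bilinear H -> K -> tensor_space} ;
  dotp_tensor : forall u v k l,
    dotp (tensor u k) (tensor v l) = dotp u v * dotp k l ;
  tensor_dense :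
    closure (lin_span [set w : tensor_space | exists u k, w = tensor u k]) =
    setT
}.

Section TensorDilation.
Context {R : realType} {H K : hilbertType R} (T : hilbert_tensor H K).

(* x is the operator b (x) c *)
Definition is_tensor_op (b : H -> H) (c : K -> K) (x : T -> T) :=
  bounded_op x /\ forall u k, x (tensor T u k) = tensor T (b u) (c k).

Definition vn_tensor (B : set (H -> H)) (C : set (K -> K)) : set (T -> T) :=
  strong_closure
    (lin_span [set x | exists b c, [/\ B b, C c & is_tensor_op b c x]]).

(* P is the conditional expectation id_B (x) psi from B (x) C to B *)
Record tensor_expectation (B : set (H -> H)) (C : set (K -> K))
    (psi : (K -> K) -> R[i]) (P : (T -> T) -> (H -> H)) : Prop :=
  TensorExpectation {
    te_range : forall x, vn_tensor B C x -> B (P x) ;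
    te_linear : linear_on (vn_tensor B C) P ;
    te_positive : forall x, vn_tensor B C x -> positive_op x ->
      positive_op (P x) ;
    te_normal : normal_on (vn_tensor B C) op_le B P ;
    te_tensor : forall b c x, B b -> C c -> is_tensor_op b c x ->
      P x = psi c *: b
  }.

Definition weak_tensor_dilation (G : hilbertType R) (A : set (G -> G))
    (B : set (H -> H)) (C : set (K -> K)) (psi : (K -> K) -> R[i])
    (S : (G -> G) -> (H -> H)) (j : (G -> G) -> (T -> T)) :=
  [/\ normal_star_hom A (vn_tensor B C) j, normal_state C psi &
      exists P, tensor_expectation B C psi P /\
        forall a, A a -> S a = P (j a)].

End TensorDilation.

Definition vector_state (R : realType) (K : hilbertType R) (k0 : K)
    (x : K -> K) : R[i] := dotp (x k0) k0.

(* Main.v *)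
From HB Require Import structures.
Require Import Defs.
From mathcomp Require Import all_boot all_order all_algebra sesquilinear.
From mathcomp Require Import complex finmap.
From mathcomp Require Import all_classical all_reals all_analysis.
From mathcomp Require Import ring lra.

(** The kernel [S (b^* a)] on [A] is positive, and Stinespring's construction
    turns it into a Hilbert space [L] that contains a vector [a (x) h] for each
    [a] in [A] and [h] in [H], carries a representation of [A], and contains an
    isometric copy [1 (x) h] of [H] with [S a] as its compression. A weak tensor
    dilation is obtained by embedding [L] into a tensor product of [H] with some
    [K], compatibly with the commutant of [B] and so that [1 (x) h] becomes
    [h (x) k0]; the representation of [A] is then transported to [H (x) K] and
    put to zero on the orthogonal complement.

    The embedding is built at once, without forming [L]
    ([kolmogorov_decomposition]). With [H (x) K] realised as square-summable
    families in [H], it is a family of functionals [phi] on [A] with values in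
    [B] such that [S (b^* a) = sum_phi phi(b)^* phi(a)], and [S] itself is to be
    one of them. Start from [S] alone, which is dominated by the kernel
    by Kadison's inequality, and take a maximal dominated family
    ([maximal_dominated]). What is left of the kernel is a positive kernel
    whose rows, suitably scaled, are admissible functionals; maximality forces
    them to vanish ([maximal_dominated_gram]). That these rows have values in
    [B] is a consequence of the bicommutant theorem ([bicommutant]), which also
    gives the unit of [A] ([vna_id]).

    Write [w a h] for the image of [a (x) h], that is, for the family of the
    [phi(a) h]. Then [j c] is the bounded operator that maps [w a h] to
    [w (c a) h] and kills the orthogonal complement ([bounded_extension]).
    It commutes with the amplified commutant of [B], so its matrix entries lie
    in [B], and an operator with entries in [B] is the strong limit of its
    finite corners, hence in [B (x) B(K)] ([entries_vn_tensor]). The conditional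
    expectation is the entry at the index of [S] ([slice_expectation]), and
    [w 1 h = h (x) k0] yields [P (j a) = S a].

    Normality is stated through least upper bounds of directed sets. By Vigier's
    theorem such a bound in a strongly closed algebra is a pointwise limit
    ([lub_weak_sup]), and a pointwise limit is a least upper bound
    ([weak_sup_lub]). Convergence of forms is a closed linear condition
    on the vector, so for [j] it is only needed at the vectors [w a h], where it
    is normality of [S] on the directed set of the [a^* d a]. *)

Set Implicit Arguments.
Unset Strict Implicit.
Unset Printing Implicit Defensive.

Import Order.TTheory GRing.Theory Num.Theory.
Import numFieldNormedType.Exports.

Local Open Scope classical_set_scope.
Local Open Scope ring_scope.
Local Open Scope complex_scope.

(** * The real-valued norm of a complex normed space *)

Section RealNorm.
Context {R : realType}.
Local Notation C := R[i].

Definition nrm (V : normedModType C) (u : V) : R := complex.Re `|u|.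

Lemma eps_div (B e : R) : 0 <= B -> 0 < e -> exists2 d, 0 < d & (1 + B) * d = e.
Proof.
move=> B0 e0; have B1 : 0 < 1 + B by rewrite ltr_wpDr.
by exists (e / (1 + B)); rewrite ?divr_gt0 // mulrC divfK ?gt_eqF.
Qed.

Section Normed.
Variable V : normedModType C.
Implicit Types u v w : V.

Lemma nrmE u : `|u| = (nrm u)%:C.
Proof. by rewrite /nrm RRe_real // normr_real. Qed.

Lemma nrm_ge0 u : 0 <= nrm u.
Proof. by rewrite -ler0c -nrmE. Qed.

Lemma nrmD u v : nrm (u + v) <= nrm u + nrm v.
Proof. by rewrite -lecR rmorphD /= -!nrmE ler_normD. Qed.

Lemma nrmN u : nrm (- u) = nrm u.
Proof. by rewrite /nrm normrN. Qed.

Lemma nrmBC u v : nrm (u - v) = nrm (v - u).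
Proof. by rewrite -nrmN opprB. Qed.

Lemma nrm0 : nrm (0 : V) = 0.
Proof. by rewrite /nrm normr0. Qed.

Lemma nrm0_eq0 u : nrm u = 0 -> u = 0.
Proof. by move=> u0; apply/eqP; rewrite -normr_eq0 nrmE u0. Qed.

Lemma nrm_gt0 u : u != 0 -> 0 < nrm u.
Proof.
move=> u0; rewrite lt_neqAle nrm_ge0 andbT; apply/eqP => n0.
by move/eqP: u0; apply; exact: nrm0_eq0.
Qed.

Lemma nrmZ (a : C) u : nrm (a *: u) = nrm (a : C^o) * nrm u.
Proof.
apply: (@complexI R); rewrite rmorphM /= -!nrmE normrZ //.
Qed.

Lemma nrm_dist_trans u v w : nrm (u - w) <= nrm (u - v) + nrm (v - w).
Proof. by rewrite (le_trans _ (nrmD _ _)) // addrA subrK. Qed.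

Lemma nrm_dist_half u v w e :
  nrm (u - v) <= e / 2 -> nrm (v - w) <= e / 2 -> nrm (u - w) <= e.
Proof.
move=> uv vw; apply: le_trans (nrm_dist_trans _ v _) _.
by rewrite [e]splitr lerD.
Qed.

Lemma nrm_lt_eq0 u : (forall e, 0 < e -> nrm u <= e) -> u = 0.
Proof.
move=> ue; apply: nrm0_eq0; apply/eqP; rewrite eq_le nrm_ge0 andbT.
by apply/ler_addgt0Pl => e /ue; rewrite addr0.
Qed.

Lemma nrm_sum (I : Type) (s : seq I) (f : I -> V) :
  nrm (\sum_(i <- s) f i) <= \sum_(i <- s) nrm (f i).
Proof.
elim: s => [|i s IH]; first by rewrite !big_nil nrm0.
by rewrite !big_cons (le_trans (nrmD _ _)) // lerD2l.
Qed.

Lemma ball_nrm u v (e : R) : ball u e%:C v = (nrm (u - v) < e).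
Proof. by rewrite -ball_normE /ball_ /= nrmE ltcR. Qed.

Lemma posC (e : C) : 0 < e -> exists2 d : R, 0 < d & e = d%:C.
Proof.
move=> e0; exists (complex.Re e); last by rewrite RRe_real // gtr0_real.
by rewrite -ltcR RRe_real // gtr0_real.
Qed.

Lemma nbhs_nrmP u (P : set V) :
  nbhs u P <-> exists2 e : R, 0 < e & forall v, nrm (u - v) < e -> P v.
Proof.
rewrite -nbhs_ballE; split.
  case=> e /= /posC[d d0 ->] dP; exists d => // v.
  by rewrite -ball_nrm => /dP.
case=> e e0 eP; exists e%:C; first by rewrite /= ltcR.
by move=> v /=; rewrite ball_nrm => /eP.
Qed.

Lemma closure_nrmP (E : set V) u :
  closure E u <-> forall e, 0 < e -> exists2 v, E v & nrm (u - v) < e.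
Proof.
split=> [cu e e0|h B /nbhs_nrmP[e e0 eB]].
  have [|v [Ev ve]] := cu [set v | nrm (u - v) < e]; last by exists v.
  by apply/nbhs_nrmP; exists e.
by have [v Ev ve] := h _ e0; exists v; split=> //; exact: eB.
Qed.

Lemma cauchy_nrmP (F : set_system V) : ProperFilter F ->
  cauchy F <-> forall e, 0 < e -> exists u, F [set v | nrm (u - v) < e].
Proof.
move=> FF; rewrite cauchyP; split=> h e.
  move=> e0; have [|u Fu] := h e%:C; first by rewrite ltcR.
  by exists u; apply: filterS Fu => v; rewrite ball_nrm.
move=> /posC[d d0 ->]; have [u Fu] := h _ d0.
by exists u; apply: filterS Fu => v; rewrite /= ball_nrm.
Qed.

Lemma cvg_nrmP (F : set_system V) u : Filter F ->
  F --> u <-> forall e, 0 < e -> F [set v | nrm (u - v) < e].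
Proof.
move=> FF; split=> [h e e0|h P /nbhs_nrmP[e e0 eP]].
  by apply: h; apply/nbhs_nrmP; exists e.
by apply: filterS (h _ e0) => v /=; exact: eP.
Qed.

End Normed.

(** Completeness in the form used throughout: [P e] is a set of approximants at
    scale [e], and any two approximants are as close as their scales allow. It
    covers minimising sequences and directed nets alike, without extracting a
    sequence. *)
Lemma small_sets_cvg (V : completeNormedModType C) (P : R -> V -> Prop) :
  (forall e, 0 < e -> exists u, P e u) ->
  (forall e d u v, 0 < e -> 0 < d -> P e u -> P d v -> nrm (u - v) <= e + d) ->
  exists w, forall e u, 0 < e -> P e u -> nrm (u - w) <= e.
Proof.
move=> Pex Psm.
pose F : set_system V := filter_from [set e : R | 0 < e]
  (fun e => [set u | exists2 d, 0 < d <= e & P d u]).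
have FF : ProperFilter F.
  apply: filter_from_proper; first last.
    by move=> e e0; have [u Pu] := Pex e e0; exists u, e => //; rewrite lexx andbT.
  apply: filter_from_filter; first by exists 1; rewrite /= ltr01.
  move=> e d e0 d0; exists (Num.min e d); first by rewrite /= lt_min e0 d0.
  by move=> u [c /andP[c0]]; rewrite le_min => /andP[ce cd] Pc; split; exists c;
    rewrite ?c0.
have /cauchy_cvg/cvg_ex[w Fw] : cauchy F.
  apply/cauchy_nrmP => e e0; have e2 : 0 < e / 3 by rewrite divr_gt0.
  have [u Pu] := Pex _ e2; exists u; exists (e / 3) => // v [d /andP[d0 de]] Pv /=.
  by apply: le_lt_trans (Psm _ _ _ _ e2 d0 Pu Pv) _; lra.
exists w => e u e0 Pu; apply/ler_addgt0Pl => c c0.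
move/cvg_nrmP: Fw => /(_ (c / 2)); have c2 : 0 < c / 2 by rewrite divr_gt0.
case=> // d d0 dw.
pose d' := Num.min d (c / 2).
have d'0 : 0 < d' by rewrite lt_min d0.
have [v Pv] := Pex _ d'0.
have : nrm (w - v) < c / 2.
  by apply: dw; exists d' => //; rewrite d'0 /= ge_min lexx.
have := Psm _ _ _ _ e0 d'0 Pu Pv.
have : d' <= c / 2 by rewrite ge_min lexx orbT.
have := nrm_dist_trans u v w; rewrite (nrmBC w v); lra.
Qed.

End RealNorm.

(** * The complex numbers as a Hilbert space *)

Section ComplexAbs.
Context {R : realType}.
Local Notation C := R[i].
Implicit Types a b : C.

Definition cabs a : R := nrm (a : C^o).

Lemma cabsE a : `|a| = (cabs a)%:C.
Proof. exact: (nrmE (a : C^o)). Qed.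

Lemma cabs_sqr a : cabs a ^+ 2 = complex.Re a ^+ 2 + complex.Im a ^+ 2.
Proof.
by apply: (@complexI R); rewrite rmorphXn /= -cabsE add_Re2_Im2.
Qed.

Lemma cabs_ge0 a : 0 <= cabs a. Proof. exact: nrm_ge0. Qed.

Lemma cabs0 : cabs 0 = 0. Proof. exact: (nrm0 (C^o)). Qed.

Lemma cabsM a b : cabs (a * b) = cabs a * cabs b.
Proof. exact: (nrmZ a (b : C^o)). Qed.

Lemma cabsD a b : cabs (a + b) <= cabs a + cabs b.
Proof. exact: (nrmD (a : C^o) b). Qed.

Lemma cabs_le_eq0 a : (forall e, 0 < e -> cabs a <= e) -> a = 0.
Proof. exact: (@nrm_lt_eq0 _ (C^o : normedModType C) a). Qed.

Lemma cabsC a : cabs (Num.conj a) = cabs a.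
Proof. by apply: (@complexI R); rewrite -!cabsE normcJ. Qed.

Lemma cabsR (x : R) : cabs x%:C = `|x|.
Proof.
apply/eqP; rewrite -(@eqrXn2 _ 2) ?cabs_ge0 //.
by rewrite cabs_sqr /= real_normK ?num_real // expr0n addr0.
Qed.

Lemma cabs_Re a : `|complex.Re a| <= cabs a.
Proof. by rewrite -lecR -cabsE normc_ge_Re. Qed.

Lemma cabs_Im a : `|complex.Im a| <= cabs a.
Proof.
rewrite -(@ler_pXn2r _ 2) ?nnegrE ?cabs_ge0 //.
by rewrite real_normK ?num_real // cabs_sqr lerDr sqr_ge0.
Qed.

Lemma cabs_le_ReIm a : cabs a <= `|complex.Re a| + `|complex.Im a|.
Proof.
rewrite -(@ler_pXn2r _ 2) ?nnegrE ?cabs_ge0 ?addr_ge0 //.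
have := real_normK (num_real (complex.Re a)).
have := real_normK (num_real (complex.Im a)).
rewrite cabs_sqr => <- <-.
by rewrite sqrrD addrAC lerDl mulrn_wge0 // mulr_ge0.
Qed.

Lemma mulcC_cabs a : a * Num.conj a = (cabs a ^+ 2)%:C.
Proof. by rewrite rmorphXn /= -cabsE sqr_normc. Qed.

(** A nonnegative quadratic expression in a complex variable forces its two
    cross terms to be conjugate and bounds them: this is the one-variable core
    of the Cauchy-Schwarz inequality for an arbitrary positive form. *)
Lemma psd_cross (al ga b b' : C) :
  0 <= ga ->
  (forall z : C, 0 <= al + Num.conj z * b + z * b' + z * Num.conj z * ga) ->
  b' = Num.conj b /\ cabs b ^+ 2 <= complex.Re al * complex.Re ga.
Proof.
move=> ga0 h.
have ga_re : ga = (complex.Re ga)%:C by rewrite RRe_real // ger0_real.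
move: (complex.Re ga) ga_re ga0 h => g -> {ga}; rewrite ler0c => g0 h.
have al0 : 0 <= al.
  by have := h 0; rewrite rmorph0 !mul0r !addr0.
have al_re : al = (complex.Re al)%:C by rewrite RRe_real // ger0_real.
move: (complex.Re al) al_re al0 h => r -> {al}; rewrite ler0c => r0 h.
case: b b' h => [b1 b2] [c1 c2] h.
(* The imaginary parts at [z = 1] and [z = i] must vanish. *)
have := h 1; have := h 'i%C.
rewrite !lecE /= => /andP[/eqP h1 _] /andP[/eqP h2 _].
have e1 : c1 = b1 by lra.
have e2 : c2 = - b2 by lra.
split; first by rewrite e1 e2.
rewrite cabs_sqr /=.
have key (t : R) : 0 <= r - 2 * t * (b1 ^+ 2 + b2 ^+ 2) +
    t ^+ 2 * (b1 ^+ 2 + b2 ^+ 2) * g.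
  have := h (- t%:C * (b1 +i* b2)); rewrite e1 e2 !lecE /= => /andP[_ hh].
  by move: hh; congr (_ <= _); ring.
have [gz|gn0] := eqVneq g 0.
  move: key; rewrite gz; set q := _ + _ => key.
  have q0 : 0 <= q by rewrite addr_ge0 // sqr_ge0.
  have [->|qn0] := eqVneq q 0; first by rewrite mulr0.
  have := key ((r + 1) / (2 * q)).
  have -> : 2 * ((r + 1) / (2 * q)) * q = r + 1 by field.
  rewrite !mulr0; lra.
have gp : 0 < g by rewrite lt_neqAle eq_sym gn0.
(* The minimum of the quadratic polynomial in [t] is at [1 / g]. *)
have := key g^-1.
have -> : r - 2 * g^-1 * (b1 ^+ 2 + b2 ^+ 2) + g^-1 ^+ 2 * (b1 ^+ 2 + b2 ^+ 2) * g
  = (r * g - (b1 ^+ 2 + b2 ^+ 2)) / g by field.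
by rewrite pmulr_lge0 ?invr_gt0 // subr_ge0 mulrC [_ * r]mulrC.
Qed.

Lemma complex_cauchy_cvg (F : set_system C^o) :
  ProperFilter F -> cauchy F -> cvg F.
Proof.
move=> FF /cauchy_nrmP Fc; apply/cvg_ex.
have part (p : C -> R) : (forall a b, p (a - b) = p a - p b) ->
    (forall a, `|p a| <= cabs a) -> exists l, (p : C^o -> R^o) @ F --> (l : R^o).
  move=> pB ple; apply/cvg_ex; apply: cauchy_cvg.
  apply/cauchyP => e /= e0; have [u Fu] := Fc e e0; exists (p u).
  rewrite /nbhs /= /fmap /=; apply: filterS Fu => v /= uv.
  have : `|p u - p v| < e by rewrite -pB; apply: le_lt_trans (ple _) _.
  by rewrite -ball_normE.
have [x Fx] := part (@complex.Re R) (fun a b => raddfB _ a b) cabs_Re.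
have [y Fy] := part (@complex.Im R) (fun a b => raddfB _ a b) cabs_Im.
exists (x +i* y); apply/cvg_nrmP => e e0.
have e2 : 0 < e / 2 by rewrite divr_gt0.
move/cvgrPdist_lt : Fx => /(_ _ e2) Fx.
move/cvgrPdist_lt : Fy => /(_ _ e2) Fy.
apply: filterS2 Fx Fy => [[a b]] /= ax bx.
move: ax bx => /= ax bx; have := cabs_le_ReIm ((x +i* y) - (a +i* b)).
set m := cabs _; have -> : nrm ((x +i* y) - (a +i* b) : C^o) = m by []. move=> /= ?.
lra.
Qed.

End ComplexAbs.

(** The complex field as a Hilbert space over itself. It has a name of its own
    because completeness of a field as a module over itself is inferred from
    the form [_^o] alone, which is reserved for real scalars. *)
Definition cline (R : realType) : Type := R[i].

Section Cline.
Context {R : realType}.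
Local Notation C := R[i].

HB.instance Definition _ := NormedModule.copy (cline R) C^o.
HB.instance Definition _ :=
  Uniform_isComplete.Build (cline R) (@complex_cauchy_cvg R).

Definition cdot (a b : cline R) : C := (a : C) * Num.conj (b : C).

Let cdot_bilinear : bilinear_for *%R (Num.conj \; *%R) cdot.
Proof.
split=> [b a x y|a k x y]; rewrite /cdot.
  by rewrite mulrDl -mulrA.
by rewrite /= rmorphD rmorphM /= mulrDr mulrCA.
Qed.

HB.instance Definition _ :=
  @bilinear_isBilinear.Build C (cline R) (cline R) C *%R (Num.conj \; *%R) cdot
    cdot_bilinear.

Let cdot_herm (a b : (cline R)) :
  cdot a b = (-1) ^+ false * Num.conj (cdot b a).
Proof. by rewrite expr0 mul1r /cdot rmorphM /= conjCK mulrC. Qed.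

HB.instance Definition _ :=
  @isHermitianSesquilinear.Build C (cline R) false Num.conj cdot cdot_herm.

Let cdot_pos (a : (cline R)) : a != 0 -> 0 < cdot a a.
Proof.
move=> a0; rewrite /cdot mulcC_cabs ltcR exprn_gt0 //; exact: nrm_gt0.
Qed.

HB.instance Definition _ :=
  @isDotProduct.Build C (cline R) cdot cdot_pos.

Let cdot_norm (a : (cline R)) : `|a| ^+ 2 = cdot a a.
Proof. by rewrite sqr_normc. Qed.

HB.instance Definition _ :=
  @NormedModule_hasDot.Build R (cline R) cdot cdot_norm.


End Cline.

(** * Bounded linear maps and inner products *)

Section LinearMaps.
Context {R : realType}.
Local Notation C := R[i].

Section Lin.
Variables (V W : lmodType C) (f : V -> W).
Hypothesis lf : linear f.

Lemma lin0 : f 0 = 0.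
Proof. by have := lf (-1) 0 0; rewrite scaler0 addr0 scaleN1r addNr. Qed.

Lemma linD u v : f (u + v) = f u + f v.
Proof. by have := lf 1 u v; rewrite !scale1r. Qed.

Lemma linZ a u : f (a *: u) = a *: f u.
Proof. by have := lf a u 0; rewrite lin0 !addr0. Qed.

Lemma linN u : f (- u) = - f u.
Proof. by rewrite -scaleN1r linZ scaleN1r. Qed.

Lemma linB u v : f (u - v) = f u - f v.
Proof. by rewrite linD linN. Qed.

Lemma lin_sum (I : Type) (s : seq I) (g : I -> V) :
  f (\sum_(i <- s) g i) = \sum_(i <- s) f (g i).
Proof.
by elim: s => [|i s IH]; rewrite ?big_nil ?lin0 // !big_cons linD IH.
Qed.

End Lin.

Definition bounded_map (V W : normedModType C) (f : V -> W) :=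
  linear f /\ exists2 M : R, 0 <= M & forall u, nrm (f u) <= M * nrm u.

Lemma bounded_map_continuous (V W : normedModType C) (f : V -> W) :
  bounded_map f -> continuous f.
Proof.
move=> [lf [M M0 fM]] u P /nbhs_nrmP[e e0 eP]; apply/nbhs_nrmP.
have M1 : 0 < M + 1 by rewrite ltr_wpDl.
exists (e / (M + 1)); first by rewrite divr_gt0.
move=> v uv /=; apply: eP; rewrite -(linB lf).
apply: le_lt_trans (fM _) _.
have := nrm_ge0 (u - v); move: uv; rewrite ltr_pdivlMr //; nra.
Qed.

Lemma continuous_bounded_map (V W : normedModType C) (f : V -> W) :
  linear f -> continuous f -> bounded_map f.
Proof.
move=> lf cf; split=> //.
have /nbhs_nrmP[e e0 eP] : nbhs (0 : V) (f @^-1` [set w | nrm (0 - w) < 1]).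
  apply: cf; rewrite (lin0 lf); apply/nbhs_nrmP; exists 1 => //.
exists (2 / e); first by rewrite divr_ge0 // ltW.
move=> u; have [->|u0] := eqVneq u 0; first by rewrite (lin0 lf) !nrm0 mulr0.
have n0 := nrm_gt0 u0; pose c := e / 2 / nrm u.
have c0 : 0 < c by rewrite !divr_gt0.
have : nrm (0 - c%:C *: u) < e.
  rewrite sub0r nrmN nrmZ -/(cabs _) cabsR gtr0_norm // /c divfK ?gt_eqF //; lra.
move=> /eP /=; rewrite sub0r nrmN (linZ lf) nrmZ -/(cabs _) cabsR gtr0_norm //.
rewrite -ltr_pdivlMl // mulr1 => /ltW /le_trans; apply.
by rewrite le_eqVlt; apply/orP; left; apply/eqP; rewrite /c; field; rewrite !gt_eqF.
Qed.

Lemma bounded_opP (H : hilbertType R) (f : H -> H) :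
  bounded_op f <-> bounded_map f.
Proof.
split=> [[lf cf]|bf]; first exact: continuous_bounded_map.
by split; [case: bf | exact: bounded_map_continuous].
Qed.

Lemma bounded_map_comp (U V W : normedModType C) (f : V -> W) (g : U -> V) :
  bounded_map f -> bounded_map g -> bounded_map (f \o g).
Proof.
move=> [lf [M M0 fM]] [lg [N N0 gN]]; split=> [a u v|]; first by rewrite /= lg lf.
exists (M * N); first exact: mulr_ge0.
by move=> u /=; rewrite (le_trans (fM _)) // -mulrA ler_wpM2l.
Qed.

Lemma fun_addE (T : Type) (W : zmodType) (f g : T -> W) u :
  (f + g) u = f u + g u.
Proof. by []. Qed.

Lemma fun_oppE (T : Type) (W : zmodType) (f : T -> W) u : (- f) u = - f u.
Proof. by []. Qed.

Lemma fun_scaleE (T : Type) (W : lmodType C) a (f : T -> W) u :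
  (a *: f) u = a *: f u.
Proof. by []. Qed.

Lemma bounded_map_lin (V W : normedModType C) (a : C) (f g : V -> W) :
  bounded_map f -> bounded_map g -> bounded_map (a *: f + g).
Proof.
move=> [lf [M M0 fM]] [lg [N N0 gN]]; split=> [b u v|].
  rewrite !(fun_addE, fun_scaleE) lf lg !scalerDr !scalerA mulrC -!addrA; congr (_ + _).
  by rewrite addrCA.
exists (cabs a * M + N); first by rewrite addr_ge0 // mulr_ge0 // cabs_ge0.
move=> u; rewrite !(fun_addE, fun_scaleE) (le_trans (nrmD _ _)) // mulrDl lerD // nrmZ -mulrA.
by rewrite ler_wpM2l // cabs_ge0.
Qed.

Lemma bounded_map_id (V : normedModType C) : bounded_map (@idfun V).
Proof. by split=> //; exists 1 => // u; rewrite mul1r. Qed.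

Lemma bounded_map_0 (V W : normedModType C) : bounded_map (0 : V -> W).
Proof.
split=> [a u v|]; first by have -> : (0 : V -> W) = fun=> 0 by []; rewrite scaler0 addr0.
by exists 0 => // u; rewrite mul0r [X in nrm X](_ : _ = 0) // nrm0.
Qed.

End LinearMaps.

Section Hilbert.
Context {R : realType}.
Local Notation C := R[i].

Section Dot.
Variable H : hilbertType R.
Implicit Types (u v w : H) (a : C).

Lemma dotDl u v w : dotp (u + v) w = dotp u w + dotp v w.
Proof. by rewrite linearDl. Qed.
Lemma dotDr u v w : dotp u (v + w) = dotp u v + dotp u w.
Proof. by rewrite linearDr. Qed.
Lemma dotZl a u w : dotp (a *: u) w = a * dotp u w.
Proof. by rewrite linearZl_LR. Qed.
Lemma dotZr a u w : dotp u (a *: w) = Num.conj a * dotp u w.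
Proof. by rewrite linearZr_LR. Qed.
Lemma dotNl u v : dotp (- u) v = - dotp u v.
Proof. by rewrite linearNl. Qed.
Lemma dotNr u v : dotp u (- v) = - dotp u v.
Proof. by rewrite linearNr. Qed.
Lemma dotBl u v w : dotp (u - v) w = dotp u w - dotp v w.
Proof. by rewrite dotDl dotNl. Qed.
Lemma dotBr u v w : dotp u (v - w) = dotp u v - dotp u w.
Proof. by rewrite dotDr dotNr. Qed.
Lemma dot0l u : dotp 0 u = 0.
Proof. by rewrite linear0l. Qed.
Lemma dot0r u : dotp u 0 = 0.
Proof. by rewrite linear0r. Qed.
Lemma dotC u v : dotp u v = Num.conj (dotp v u).
Proof. by rewrite (hermC dotp) expr0 mul1r. Qed.
Lemma dot_suml (I : Type) (s : seq I) (g : I -> H) v :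
  dotp (\sum_(i <- s) g i) v = \sum_(i <- s) dotp (g i) v.
Proof. by rewrite linear_sumlz. Qed.
Lemma dot_sumr (I : Type) (s : seq I) (g : I -> H) v :
  dotp v (\sum_(i <- s) g i) = \sum_(i <- s) dotp v (g i).
Proof. by rewrite linear_sumr. Qed.

Lemma dot_nrm u : dotp u u = (nrm u ^+ 2)%:C.
Proof. by rewrite -dotp_norm nrmE rmorphXn. Qed.

Lemma dot_ge0 u : 0 <= dotp u u.
Proof. by rewrite dot_nrm ler0c sqr_ge0. Qed.

Lemma nrm_sqr u : nrm u ^+ 2 = complex.Re (dotp u u).
Proof. by rewrite dot_nrm. Qed.

Lemma dotDD u v (z : C) : dotp (u + z *: v) (u + z *: v) =
  dotp u u + Num.conj z * dotp u v + z * dotp v u + z * Num.conj z * dotp v v.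
Proof. by rewrite !dotDl !dotDr !dotZl !dotZr mulrA !addrA. Qed.

Lemma dot_le u v : cabs (dotp u v) <= nrm u * nrm v.
Proof.
have [_] : dotp v u = Num.conj (dotp u v) /\
    cabs (dotp u v) ^+ 2 <= complex.Re (dotp u u) * complex.Re (dotp v v).
  by apply: psd_cross (dot_ge0 v) _ => z; rewrite -dotDD dot_ge0.
rewrite -!nrm_sqr -exprMn ler_pXn2r // nnegrE ?cabs_ge0 //.
by rewrite mulr_ge0 // nrm_ge0.
Qed.

Lemma nrm_sqrD u v :
  nrm (u + v) ^+ 2 = nrm u ^+ 2 + nrm v ^+ 2 + 2 * complex.Re (dotp u v).
Proof.
rewrite !nrm_sqr dotDl !dotDr (dotC v u).
by case: (dotp u u) (dotp v v) (dotp u v) => [a b] [c d] [e f] /=; ring.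
Qed.

Lemma parallelogram u v :
  nrm (u + v) ^+ 2 + nrm (u - v) ^+ 2 = 2 * nrm u ^+ 2 + 2 * nrm v ^+ 2.
Proof.
by rewrite !nrm_sqrD nrmN dotNr raddfN /=; ring.
Qed.

Lemma dot_inj v w : (forall u, dotp u v = dotp u w) -> v = w.
Proof.
move=> vw; apply/eqP; rewrite -subr_eq0; apply/eqP/nrm0_eq0/eqP.
by rewrite -sqrf_eq0 nrm_sqr dotBr vw subrr.
Qed.

Lemma dot_eq0 v : (forall u, dotp u v = 0) -> v = 0.
Proof. by move=> v0; apply: dot_inj => u; rewrite v0 dot0r. Qed.

End Dot.

Definition closed_subspace (H : hilbertType R) (M : set H) :=
  [/\ M 0, forall (a : C) u v, M u -> M v -> M (a *: u + v) &
      forall u, (forall e, 0 < e -> exists2 v, M v & nrm (u - v) <= e) -> M u].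

(** Riesz representation relative to a closed subspace [M]: minimise
    [|u|^2 - 2 Re f u] on [M]. Near-minimisers are close to each other by the
    parallelogram law, and represent [f] up to a small error. *)
Lemma riesz_subspace (H : hilbertType R) (M : set H) (f : H -> C) (B : R) :
  closed_subspace M -> linear (f : H -> C^o) ->
  (forall u, cabs (f u) <= B * nrm u) ->
  exists2 w, M w & forall u, M u -> f u = dotp u w.
Proof.
move=> [M0 Ml Mc] lf fB.
pose J u := nrm u ^+ 2 - 2 * complex.Re (f u).
have MZ a u : M u -> M (a *: u) by move=> Mu; rewrite -[_ *: _]addr0; exact: Ml.
have MD u v : M u -> M v -> M (u + v) by rewrite -{2}[u]scale1r; exact: Ml.
have JB u : - B ^+ 2 <= J u.
  rewrite /J; have := le_trans (cabs_Re _) (fB u).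
  rewrite ler_norml => /andP[_]; have := sqr_ge0 (nrm u - B); nra.
pose E := [set J u | u in M].
have Einf : has_inf E.
  split; first by exists (J 0), 0.
  by exists (- B ^+ 2) => _ [u _ <-]; exact: JB.
pose m := inf E.
have mJ u : M u -> m <= J u.
  by move=> Mu; apply: ge_inf; [case: Einf | exists u].
pose P (e : R) u := M u /\ J u <= m + e ^+ 2 / 2.
have Pex e : 0 < e -> exists u, P e u.
  move=> e0; have e2 : 0 < e ^+ 2 / 2 by rewrite divr_gt0 // exprn_gt0.
  have [_ [u Mu <-] Ju] := inf_adherent e2 Einf.
  by exists u; split=> //; exact: ltW.
have Psm e d u v : 0 < e -> 0 < d -> P e u -> P d v -> nrm (u - v) <= e + d.
  move=> e0 d0 [Mu Ju] [Mv Jv].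
  have := mJ _ (MZ (2^-1)%:C _ (MD _ _ Mu Mv)).
  move: Ju Jv; rewrite /J nrmZ -/(cabs _) cabsR gtr0_norm ?invr_gt0 //.
  rewrite (linZ lf) (linD lf) => Ju Jv.
  have -> : complex.Re ((2^-1)%:C *: (f u + f v : C^o)) =
      2^-1 * (complex.Re (f u) + complex.Re (f v)).
    by rewrite -[_ *: _]/(_ * _); case: (f u) (f v) => [? ?] [? ?] /=; ring.
  have := parallelogram u v => pl Jm.
  rewrite -(@ler_pXn2r _ 2) ?nnegrE ?nrm_ge0 ?addr_ge0 ?ltW //.
  nra.
have [w Pw] := small_sets_cvg Pex Psm.
exists w.
  apply: Mc => e e0; have [u Pu] := Pex e e0; exists u; first by case: Pu.
  by rewrite nrmBC; exact: Pw.
move=> v Mv; apply/eqP; rewrite -subr_eq0; apply/eqP.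
apply: cabs_le_eq0 => e e0.
pose d := e / (1 + 2 * nrm v).
have nv := nrm_ge0 v.
have d0 : 0 < d by rewrite divr_gt0 //; lra.
have de : d * (1 + 2 * nrm v) = e by rewrite /d divfK // gt_eqF //; lra.
move: d d0 de => d d0 de.
have [u Pu] := Pex d d0; have [Mu Ju] := Pu.
have [_] : f v - dotp v u = Num.conj (Num.conj (f v - dotp v u)) /\
    cabs (Num.conj (f v - dotp v u)) ^+ 2 <=
    complex.Re (d ^+ 2 / 2)%:C * complex.Re (dotp v v).
  apply: psd_cross (dot_ge0 v) _ => z.
  have := mJ _ (MD _ _ Mu (MZ (- z) _ Mv)); move: Ju.
  rewrite /J nrm_sqrD (linD lf) (linZ lf) -[- z *: (f v : C^o)]/(- z * f v).
  rewrite dotZr nrmZ -/(cabs _) [(cabs _ * _) ^+ 2]exprMn dot_nrm (dotC v u).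
  rewrite cabs_sqr.
  move: (nrm u ^+ 2) (nrm v ^+ 2) (d ^+ 2 / 2) => x y d2.
  case: (f u) (f v) (dotp u v) z => [f1 f2] [g1 g2] [a b] [z1 z2] /= h1 h2.
  rewrite lecE /=; apply/andP; split; first by apply/eqP; ring.
  lra.
rewrite cabsC /= -nrm_sqr => h.
have {}h : cabs (f v - dotp v u) <= d * nrm v.
  rewrite -(@ler_pXn2r _ 2) ?nnegrE ?cabs_ge0 ?mulr_ge0 ?(ltW d0) //.
  by apply: le_trans h _; rewrite [(d * _) ^+ 2]exprMn ler_wpM2r ?sqr_ge0 //; have := sqr_ge0 d; lra.
have hw := dot_le v (u - w).
have -> : f v - dotp v w = (f v - dotp v u) + dotp v (u - w).
  by rewrite dotBr addrA subrK.
apply: le_trans (cabsD _ _) _.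
have uw := Pw _ _ d0 Pu.
have : nrm v * nrm (u - w) <= nrm v * d by rewrite ler_wpM2l.
lra.
Qed.

End Hilbert.

(** * Orthogonal projections, adjoints and extension of operators *)

Section Projection.
Context {R : realType}.
Local Notation C := R[i].

Lemma riesz (H : hilbertType R) (f : H -> C) (B : R) :
  linear (f : H -> C^o) -> (forall u, cabs (f u) <= B * nrm u) ->
  exists w, forall u, f u = dotp u w.
Proof.
move=> lf fB; have MT : closed_subspace (setT : set H) by split.
by have [w _ fw] := riesz_subspace MT lf fB; exists w => u; exact: fw.
Qed.

Lemma orth_proj_ex (H : hilbertType R) (M : set H) : closed_subspace M ->
  forall u, exists2 p, M p & forall v, M v -> dotp v (u - p) = 0.
Proof.
move=> cM u; have l : linear ((fun v => dotp v u) : H -> C^o).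
  by move=> a x y; rewrite dotDl dotZl.
have [|w Mw fw] := @riesz_subspace R H M _ (nrm u) cM l.
  by move=> v; rewrite mulrC dot_le.
by exists w => // v Mv; rewrite dotBr fw // subrr.
Qed.

Section ClosedSubspace.
Variables (H : hilbertType R) (M : set H).
Hypothesis cM : closed_subspace M.

Lemma csub0 : M 0. Proof. by case: cM. Qed.
Lemma csubD u v : M u -> M v -> M (u + v).
Proof. by case: cM => _ h _ Mu Mv; have := h 1 u v Mu Mv; rewrite scale1r. Qed.
Lemma csubZ a u : M u -> M (a *: u).
Proof. by case: cM => h0 h _ Mu; have := h a u 0 Mu h0; rewrite addr0. Qed.
Lemma csubB u v : M u -> M v -> M (u - v).
Proof. by move=> Mu Mv; apply: csubD => //; rewrite -scaleN1r; exact: csubZ. Qed.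
Lemma csub_sum (I : Type) (s : seq I) (f : I -> H) :
  (forall i, M (f i)) -> M (\sum_(i <- s) f i).
Proof.
move=> Mf; elim: s => [|i s IH]; first by rewrite big_nil; exact: csub0.
by rewrite big_cons; exact: csubD.
Qed.

Definition orth_proj u : H := sval (cid2 (orth_proj_ex cM u)).

Lemma orth_projM u : M (orth_proj u).
Proof. by rewrite /orth_proj; case: cid2. Qed.

Lemma orth_proj_perp u v : M v -> dotp v (u - orth_proj u) = 0.
Proof. by rewrite /orth_proj; case: cid2 => p /= _; exact. Qed.

Lemma orth_proj_unique u p :
  M p -> (forall v, M v -> dotp v (u - p) = 0) -> orth_proj u = p.
Proof.
move=> Mp ph; apply/eqP; rewrite -subr_eq0; apply/eqP/nrm0_eq0/eqP.
have Md : M (orth_proj u - p) by apply: csubB => //; exact: orth_projM.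
rewrite -sqrf_eq0 nrm_sqr.
have -> : dotp (orth_proj u - p) (orth_proj u - p) =
    dotp (orth_proj u - p) (u - p) - dotp (orth_proj u - p) (u - orth_proj u).
  by rewrite -dotBr; congr (dotp _ _); rewrite opprB [RHS]addrC addrA subrK.
by rewrite ph // orth_proj_perp // subrr.
Qed.

Lemma orth_proj_id u : M u -> orth_proj u = u.
Proof. by move=> Mu; apply: orth_proj_unique => // v _; rewrite subrr dot0r. Qed.

Lemma orth_proj0 u : (forall v, M v -> dotp v u = 0) -> orth_proj u = 0.
Proof. by move=> h; apply: orth_proj_unique => [|v]; [exact: csub0|rewrite subr0; exact: h]. Qed.

Lemma orth_proj_linear : linear orth_proj.
Proof.
move=> a u v; apply: orth_proj_unique => [|w Mw].
  by apply: csubD; [apply: csubZ|]; exact: orth_projM.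
rewrite opprD addrACA -scalerBr dotDr dotZr !orth_proj_perp //.
by rewrite mulr0 addr0.
Qed.

Lemma nrm_orth_proj u : nrm (orth_proj u) <= nrm u.
Proof.
rewrite -(@ler_pXn2r _ 2) ?nnegrE ?nrm_ge0 //.
have {2}-> : u = orth_proj u + (u - orth_proj u) by rewrite addrC subrK.
rewrite nrm_sqrD orth_proj_perp; last exact: orth_projM.
by rewrite mulr0 addr0 lerDl sqr_ge0.
Qed.

Lemma orth_proj_bounded : bounded_map orth_proj.
Proof. by split; [exact: orth_proj_linear|exists 1 => // u; rewrite mul1r nrm_orth_proj]. Qed.

End ClosedSubspace.

(** The closed linear span, as the least closed subspace: its elimination rule
    serves wherever the property to be extended by density is itself a closed
    linear one. *)
Definition closed_span (H : hilbertType R) (S : set H) : set H :=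
  [set u | forall M, closed_subspace M -> S `<=` M -> M u].

Lemma closed_span_closed (H : hilbertType R) (S : set H) :
  closed_subspace (closed_span S).
Proof.
split=> [M cM _|a u v hu hv M cM SM|u hu M cM SM]; first exact: csub0.
  by apply: csubD (csubZ cM _ (hu _ cM SM)) (hv _ cM SM).
case: (cM) => _ _; apply => e e0; have [v hv uv] := hu e e0.
by exists v => //; exact: hv.
Qed.

Lemma sub_closed_span (H : hilbertType R) (S : set H) : S `<=` closed_span S.
Proof. by move=> u Su M _; exact. Qed.

Lemma perp_closed (H : hilbertType R) (S : set H) :
  closed_subspace [set u | forall s, S s -> dotp s u = 0].
Proof.
split=> [s _|a u v hu hv s Ss|u hu s Ss]; first by rewrite dot0r.
  by rewrite dotDr dotZr hu // hv // mulr0 addr0.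
apply: cabs_le_eq0 => e e0.
have ns := nrm_ge0 s; have [d d0 de] := eps_div ns e0.
have [v hv uv] := hu _ d0.
have -> : dotp s u = dotp s (u - v) by rewrite dotBr hv // subr0.
apply: le_trans (dot_le _ _) _.
by have := nrm_ge0 (u - v); nra.
Qed.

Lemma closed_span_perp (H : hilbertType R) (S : set H) v :
  (forall s, S s -> dotp s v = 0) ->
  forall u, closed_span S u -> dotp u v = 0.
Proof.
move=> Sv u /(_ _ (perp_closed [set v])) h; rewrite dotC h ?conjC0 // => s Ss _ -> .
by rewrite dotC Sv // conjC0.
Qed.

(** A closed linear condition holds everywhere as soon as it holds on a set and
    on its orthogonal complement. *)
Lemma total_ind (H : hilbertType R) (S P : set H) : closed_subspace P ->
  S `<=` P -> (forall u, (forall s, S s -> dotp s u = 0) -> P u) ->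
  forall u, P u.
Proof.
move=> cP SP pP u; have cS := closed_span_closed S.
rewrite -[u](subrK (orth_proj cS u)); apply: csubD => //.
  by apply: pP => s Ss; apply: orth_proj_perp; exact: sub_closed_span.
exact: (orth_projM cS u _ cP SP).
Qed.

Lemma eq_closed (H W : hilbertType R) (f g : H -> W) :
  bounded_map f -> bounded_map g -> closed_subspace [set u | f u = g u].
Proof.
move=> bf bg; have [lh [M M0 hM]] := bounded_map_lin (-1) bg bf.
have h_eq u : f u = g u <-> (-1 *: g + f) u = 0.
  rewrite fun_addE fun_scaleE scaleN1r addrC.
  by split=> [->|/eqP]; [rewrite subrr|rewrite subr_eq0 => /eqP].
split=> [|a u v|u hu].
- by rewrite /= (lin0 (proj1 bf)) (lin0 (proj1 bg)).
- by rewrite /= (proj1 bf) (proj1 bg) => -> ->.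
apply/h_eq/nrm_lt_eq0 => e e0.
have [d d0 de] := eps_div M0 e0.
have [v /h_eq hv uv] := hu _ d0.
have -> : (-1 *: g + f) u = (-1 *: g + f) (u - v) by rewrite (linB lh) hv subr0.
apply: le_trans (hM _) _.
by have := nrm_ge0 (u - v); nra.
Qed.

Lemma adjoint_ex (H W : hilbertType R) (f : H -> W) : bounded_map f ->
  exists2 g : W -> H, bounded_map g & forall u v, dotp (f u) v = dotp u (g v).
Proof.
move=> [lf [M M0 fM]].
have ex v : exists w, forall u, dotp (f u) v = dotp u w.
  apply: (@riesz _ _ (M * nrm v)) => [a x y|u]; first by rewrite lf dotDl dotZl.
  apply: le_trans (dot_le _ _) _; rewrite mulrAC ler_wpM2r ?nrm_ge0 //.
have [g fg] := choice ex; exists g => //; split=> [a u v|].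
  by apply: dot_inj => x; rewrite dotDr dotZr -!fg dotDr dotZr.
exists M => // v; have [->|gv0] := eqVneq (g v) 0.
  by rewrite nrm0 mulr_ge0 // nrm_ge0.
have n0 := nrm_gt0 gv0; rewrite -(ler_pM2l n0) -expr2 nrm_sqr -fg.
apply: le_trans (ler_norm _) _; apply: le_trans (cabs_Re _) _.
apply: le_trans (dot_le _ _) _; rewrite mulrA ler_wpM2r ?nrm_ge0 // mulrC.
exact: fM.
Qed.

Lemma closed_span_approx (H : hilbertType R) (X : Type) (s : X -> H) u :
  closed_span (range s) u -> forall e, 0 < e ->
  exists l : seq (C * X), nrm (u - \sum_(p <- l) p.1 *: s p.2) <= e.
Proof.
move=> hu; apply: (hu [set u | forall e, 0 < e ->
  exists l : seq (C * X), nrm (u - \sum_(p <- l) p.1 *: s p.2) <= e]); last first.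
  move=> _ [x _ <-] e e0; exists [:: (1, x)].
  by rewrite big_seq1 scale1r subrr nrm0 ltW.
split=> [e e0|a v w hv hw e e0|v hv e e0].
- by exists [::]; rewrite big_nil subr0 nrm0 ltW.
- have na := cabs_ge0 a; have [d d0 de] := eps_div na e0.
  have [l l1] := hv _ d0; have [k k1] := hw _ d0.
  exists ([seq (a * p.1, p.2) | p <- l] ++ k); rewrite big_cat big_map /=.
  under eq_bigr do rewrite -scalerA.
  rewrite -scaler_sumr opprD addrACA -scalerBr (le_trans (nrmD _ _)) // nrmZ -/(cabs a).
  by nra.
- have e2 : 0 < e / 2 by rewrite divr_gt0.
  have [w hw vw] := hv _ e2; have [l wl] := hw _ e2; exists l.
  exact: nrm_dist_half vw wl.
Qed.

(** A correspondence [s x |-> t x] that does not increase norms of linear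
    combinations by more than a constant factor extends to a bounded operator,
    chosen to vanish on the orthogonal complement of the [s x]. *)
Lemma bounded_extension (H W : hilbertType R) (X : Type) (s : X -> H)
    (t : X -> W) (M : R) : 0 <= M ->
  (forall l : seq (C * X), nrm (\sum_(p <- l) p.1 *: t p.2) <=
     M * nrm (\sum_(p <- l) p.1 *: s p.2)) ->
  exists f : H -> W, [/\ bounded_map f, forall x, f (s x) = t x,
    forall u, (forall x, dotp (s x) u = 0) -> f u = 0 &
    forall N : set W, closed_subspace N -> (forall x, N (t x)) -> forall u, N (f u)].
Proof.
move=> M0 st.
pose Ls (l : seq (C * X)) := \sum_(p <- l) p.1 *: s p.2.
pose Lt (l : seq (C * X)) := \sum_(p <- l) p.1 *: t p.2.
pose sc (a : C) (l : seq (C * X)) := [seq (a * p.1, p.2) | p <- l].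
have LsP a l k : Ls (sc a l ++ k) = a *: Ls l + Ls k.
  rewrite /Ls big_cat big_map scaler_sumr; congr (_ + _).
  by apply: eq_bigr => p _; rewrite scalerA.
have LtP a l k : Lt (sc a l ++ k) = a *: Lt l + Lt k.
  rewrite /Lt big_cat big_map scaler_sumr; congr (_ + _).
  by apply: eq_bigr => p _; rewrite scalerA.
pose S := range s; have cS := closed_span_closed S.
pose rel u w := forall e, 0 < e ->
  exists l, nrm (u - Ls l) <= e /\ nrm (w - Lt l) <= e.
have relP a u v w z : rel u w -> rel v z -> rel (a *: u + v) (a *: w + z).
  move=> uw vz e e0; have na := cabs_ge0 a.
  have [d d0 de] := eps_div na e0.
  have [l [l1 l2]] := uw _ d0; have [k [k1 k2]] := vz _ d0.
  exists (sc a l ++ k); rewrite LsP LtP !opprD.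
  split; rewrite addrACA -scalerBr (le_trans (nrmD _ _)) // nrmZ -/(cabs a); nra.
have rel_le u w : rel u w -> nrm w <= M * nrm u.
  move=> uw; apply/ler_addgt0Pl => e e0.
  have [d d0 de] := eps_div M0 e0.
  have [l [l1 l2]] := uw _ d0; have := st l; rewrite -/(Ls l) -/(Lt l) => lM.
  have := nrmD (w - Lt l) (Lt l); rewrite subrK => h1.
  have := nrmD (Ls l - u) u; rewrite subrK (nrmBC (Ls l)) => h2.
  have : M * nrm (Ls l) <= M * (d + nrm u) by rewrite ler_wpM2l //; lra.
  lra.
have rel_inj u w z : rel u w -> rel u z -> w = z.
  move=> uw uz; have := rel_le _ _ (relP (-1) _ _ _ _ uw uz).
  rewrite !scaleN1r addNr nrm0 mulr0 => h.
  by apply/eqP; rewrite eq_sym -subr_eq0 addrC; apply/eqP/nrm0_eq0/eqP;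
     rewrite eq_le h nrm_ge0.
have rels x : rel (s x) (t x).
  move=> e e0; exists [:: (1, x)].
  by rewrite /Ls /Lt !big_seq1 !scale1r !subrr !nrm0 ltW.
have rel_closed u : (forall e, 0 < e -> exists l, nrm (u - Ls l) <= e) ->
    exists w, rel u w.
  move=> hu.
  pose P e w := exists2 l, nrm (u - Ls l) <= e / (1 + M) & w = Lt l.
  have M1 : 0 < 1 + M by lra.
  have [||w hw] := @small_sets_cvg R W P.
  - move=> e e0; have d0 : 0 < e / (1 + M) by rewrite divr_gt0.
    by have [l ul] := hu _ d0; exists (Lt l), l.
  - move=> e d _ _ e0 d0 [l ul ->] [k uk ->].
    have := st (sc (-1) k ++ l); rewrite -/(Ls _) -/(Lt _) LsP LtP !scaleN1r.
    rewrite ![- _ + _]addrC => /le_trans; apply.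
    have := nrm_dist_trans (Ls l) u (Ls k); rewrite (nrmBC (Ls l)) => h.
    have := nrm_ge0 (Ls l - Ls k).
    have := ler_wpM2l (ltW M1) h.
    move: ul uk; rewrite !ler_pdivlMr // (nrmBC (Ls l) u) (nrmBC (Ls l) (Ls k)); lra.
  exists w => e e0.
  have d0 : 0 < e / (1 + M) by rewrite divr_gt0.
  have [l ul] := hu _ d0; exists l; split.
    apply: le_trans ul _; rewrite ler_pdivrMr // ler_peMr //; lra.
  by rewrite nrmBC; apply: hw e0 _; exists l.
have rel_span u : closed_span S u -> exists w, rel u w.
  by move=> hu; apply: rel_closed; exact: closed_span_approx.
have [g hg] := choice (fun u => rel_span _ (orth_projM cS u)).
exists g; split.
- split=> [a u v|].
    apply: (rel_inj (orth_proj cS (a *: u + v))) => //.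
    by rewrite (orth_proj_linear cS); apply: relP.
  exists M => // u; apply: le_trans (rel_le _ _ (hg u)) _.
  by rewrite ler_wpM2l // nrm_orth_proj.
- move=> x; apply: (rel_inj (s x)) => //.
  by rewrite -{1}[s x](orth_proj_id cS) //; apply: sub_closed_span; exists x.
- move=> u hu; apply: (rel_inj 0).
    rewrite -[X in rel X](_ : orth_proj cS u = 0) //; apply: orth_proj0 => v.
    by apply: closed_span_perp => _ [x _ <-].
  by move=> e e0; exists [::]; rewrite /Ls /Lt !big_nil !subr0 !nrm0 ltW.
move=> N cN tN u; case: (cN) => _ _; apply => e e0.
have [l [_ gl]] := hg u e e0; exists (Lt l) => //.
by apply: csub_sum => // p; exact: csubZ.
Qed.

End Projection.

(** * Unordered sums and square-summable families *)

Section UnorderedSum.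
Context {R : realType} {I : choiceType}.
Local Notation C := R[i].

Lemma sum_fsetDK (V : zmodType) (A B : {fset I}) (F : I -> V) :
  (A `<=` B)%fset ->
  \sum_(i <- B) F i = \sum_(i <- A) F i + \sum_(i <- (B `\` A)%fset) F i.
Proof.
move=> AB; rewrite (big_fsetID _ (mem A)) /=; congr (_ + _).
  apply: eq_fbigl => i; rewrite !inE /= andbC.
  by case iA: (i \in A) => //=; rewrite (fsubsetP AB).
by apply: eq_fbigl => i; rewrite !inE /= andbC.
Qed.

Lemma ler_sum_fset (A B : {fset I}) (p : I -> R) : (forall i, 0 <= p i) ->
  (A `<=` B)%fset -> \sum_(i <- A) p i <= \sum_(i <- B) p i.
Proof. by move=> p0 AB; rewrite (sum_fsetDK _ AB) lerDl sumr_ge0. Qed.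

Definition fsum_to (F : I -> C) (s : C) := forall e, 0 < e ->
  exists E0 : {fset I}, forall E : {fset I}, (E0 `<=` E)%fset ->
    cabs (\sum_(i <- E) F i - s) <= e.

(** Beyond a finite set that nearly exhausts the sum of the [p i], every further
    finite sum of the [p i], hence of the [F i], is small. *)
Lemma fsum_to_ex (F : I -> C) (p : I -> R) (B : R) :
  (forall i, cabs (F i) <= p i) ->
  (forall E : {fset I}, \sum_(i <- E) p i <= B) -> exists s, fsum_to F s.
Proof.
move=> Fp pB; have p0 i : 0 <= p i := le_trans (cabs_ge0 _) (Fp i).
pose S := [set \sum_(i <- E) p i | E in [set: {fset I}]].
have hS : has_sup S.
  split; first by exists (\sum_(i <- fset0) p i), fset0.
  by exists B => _ [E _ <-].
pose P (e : R) (u : cline R) := exists2 E0 : {fset I}, u = \sum_(i <- E0) F i &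
  forall E : {fset I}, (E0 `<=` E)%fset -> cabs (\sum_(i <- E) F i - u) <= e.
have Pex e : 0 < e -> exists u, P e u.
  move=> e0; have [_ [E0 _ <-] hE0] := sup_adherent e0 hS.
  exists (\sum_(i <- E0) F i); exists E0 => // E sE.
  rewrite (sum_fsetDK _ sE) addrC addKr.
  apply: le_trans (_ : \sum_(i <- (E `\` E0)%fset) p i <= _).
    apply: le_trans (nrm_sum _ (F : I -> C^o)) _.
    by apply: ler_sum => i _; exact: Fp.
  have : \sum_(i <- E) p i <= sup S by apply: ub_le_sup; [case: hS | exists E].
  rewrite (sum_fsetDK _ sE); lra.
have [|w hw] := small_sets_cvg Pex.
  move=> e d _ _ e0 d0 [E -> hE] [E' -> hE'].
  have := hE _ (fsubsetUl E E'); have := hE' _ (fsubsetUr E E').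
  set x := \sum_(i <- E) _; set y := \sum_(i <- E') _; set z := \sum_(i <- _) _.
  have -> : nrm (x - y : cline R) = cabs (- (z - x) + (z - y)).
    by rewrite -[LHS]/(cabs (x - y)); congr (cabs _); ring.
  move=> h1 h2; apply: le_trans (cabsD _ _) _.
  have -> : cabs (- (z - x)) = cabs (z - x) by exact: (nrmN (_ : C^o)).
  exact: lerD.
exists w => e e0; have e2 : 0 < e / 2 by rewrite divr_gt0.
have [u Pu] := Pex _ e2; have := hw _ _ e2 Pu.
case: Pu => E0 _ hE0 uw; exists E0 => E /hE0 h.
have -> : \sum_(i <- E) F i - w = (\sum_(i <- E) F i - u) + (u - w :> C) by ring.
apply: le_trans (cabsD _ _) _.
have {}uw : cabs (u - w :> C) <= e / 2 by [].
lra.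
Qed.

Lemma fsum_to_close (F : I -> C) s : fsum_to F s -> forall e (E0 : {fset I}), 0 < e ->
  exists2 E : {fset I}, (E0 `<=` E)%fset & cabs (\sum_(i <- E) F i - s) <= e.
Proof.
move=> hF e E0 e0; have [E1 h] := hF e e0.
by exists (E0 `|` E1)%fset; [exact: fsubsetUl | apply: h; exact: fsubsetUr].
Qed.

Lemma fsum_to_lin (F G : I -> C) s t a : fsum_to F s -> fsum_to G t ->
  fsum_to (fun i => a * F i + G i) (a * s + t).
Proof.
move=> hF hG e e0; have na := cabs_ge0 a.
have [d d0 de] := eps_div na e0.
have [E h] := hF _ d0; have [E' h'] := hG _ d0; exists (E `|` E')%fset => E2 sE.
have {}h := h _ (fsubset_trans (fsubsetUl _ _) sE).
have {}h' := h' _ (fsubset_trans (fsubsetUr _ _) sE).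
rewrite big_split -mulr_sumr /=.
have -> : a * (\sum_(i <- E2) F i) + \sum_(i <- E2) G i - (a * s + t) =
  a * (\sum_(i <- E2) F i - s) + (\sum_(i <- E2) G i - t) by ring.
apply: le_trans (cabsD _ _) _; rewrite cabsM; nra.
Qed.

Lemma fsum_to_conj (F : I -> C) s :
  fsum_to F s -> fsum_to (fun i => Num.conj (F i)) (Num.conj s).
Proof.
move=> hF e e0; have [E h] := hF e e0; exists E => E' /h.
by rewrite -(cabsC (_ - s)) rmorphB /= rmorph_sum.
Qed.

Lemma fsum_to_inj (F : I -> C) s t : fsum_to F s -> fsum_to F t -> s = t.
Proof.
move=> hs ht; apply/eqP; rewrite -subr_eq0; apply/eqP/cabs_le_eq0 => e e0.
have e2 : 0 < e / 2 by rewrite divr_gt0.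
have [E0 h0] := hs _ e2; have [E sE hE] := fsum_to_close ht E0 e2.
have := h0 _ sE; rewrite -[cabs _](nrmN (_ : C^o)) -/(cabs _).
have -> : s - t = - (\sum_(i <- E) F i - s) + (\sum_(i <- E) F i - t) by ring.
by move=> h; apply: le_trans (cabsD _ _) _; move: h hE; rewrite /cabs /=; lra.
Qed.

Lemma fsum_to_Re_ge (p : I -> R) s (E : {fset I}) : (forall i, 0 <= p i) ->
  fsum_to (fun i => (p i)%:C) s -> \sum_(i <- E) p i <= complex.Re s.
Proof.
move=> p0 hs; apply/ler_addgt0Pl => e e0.
have [E' sE hE] := fsum_to_close hs E e0.
have := le_trans (cabs_Re _) hE; rewrite -rmorph_sum raddfB /= ler_norml.
have := ler_sum_fset p0 sE; set x := \sum_(i <- E) _; set y := \sum_(i <- E') _.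
by move=> xy /andP[_]; lra.
Qed.

Lemma fsum_to_Re_le (p : I -> R) s B :
  fsum_to (fun i => (p i)%:C) s -> (forall E : {fset I}, \sum_(i <- E) p i <= B) ->
  complex.Re s <= B.
Proof.
move=> hs pB; apply/ler_addgt0Pl => e e0.
have [E' sE hE] := fsum_to_close hs fset0 e0.
have := le_trans (cabs_Re _) hE; rewrite -rmorph_sum raddfB /= ler_norml.
by have := pB E'; set y := \sum_(i <- E') _; move=> xy /andP[]; lra.
Qed.

End UnorderedSum.

Section SquareSummable.
Context {R : realType}.
Local Notation C := R[i].
Variables (I : choiceType) (H : hilbertType R).

Definition square_summable : {pred I -> H} :=
  fun f => `[< exists B, forall E : {fset I}, \sum_(i <- E) nrm (f i) ^+ 2 <= B >].

Record l2 := L2 { l2val :> I -> H; l2P : l2val \in square_summable }.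

HB.instance Definition _ := [isSub for l2val].
HB.instance Definition _ := [Choice of l2 by <:].

Lemma square_summableP (f : I -> H) : reflect
  (exists B, forall E : {fset I}, \sum_(i <- E) nrm (f i) ^+ 2 <= B)
  (f \in square_summable).
Proof. exact: asboolP. Qed.

Lemma square_summable_submod : submod_closed square_summable.
Proof.
split; first by apply/square_summableP; exists 0 => E; rewrite big1 // => i _;
  rewrite -[X in nrm X]/(0 : H) nrm0 expr0n.
move=> a f g /square_summableP[B fB] /square_summableP[D gD].
apply/square_summableP; exists (2 * cabs a ^+ 2 * B + 2 * D) => E.
have ca : 0 <= 2 * cabs a ^+ 2 by rewrite mulr_ge0 // sqr_ge0.
have := lerD (ler_wpM2l ca (fB E)) (ler_wpM2l (ler0n R 2) (gD E)).
apply: le_trans; rewrite !mulr_sumr -big_split; apply: ler_sum => i _ /=.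
have -> : (a *: f + g) i = a *: f i + g i by [].
have := parallelogram (a *: f i) (g i); rewrite [nrm (a *: _)]nrmZ -/(cabs a) exprMn.
by have := sqr_ge0 (nrm (a *: f i - g i)); lra.
Qed.

HB.instance Definition _ :=
  GRing.isSubmodClosed.Build C (I -> H) square_summable square_summable_submod.
HB.instance Definition _ := [SubChoice_isSubLmodule of l2 by <:].

Lemma l2_add (f g : l2) i : (f + g) i = f i + g i. Proof. by []. Qed.
Lemma l2_opp (f : l2) i : (- f) i = - f i. Proof. by []. Qed.
Lemma l2_scale a (f : l2) i : (a *: f) i = a *: f i. Proof. by []. Qed.
Lemma l2_ext (f g : l2) : (forall i, f i = g i) -> f = g.
Proof. by move=> fg; apply/val_inj/funext. Qed.

Lemma l2dot_ex (f g : l2) : exists s, fsum_to (fun i => dotp (f i) (g i)) s.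
Proof.
have /square_summableP[B fB] := l2P f; have /square_summableP[D gD] := l2P g.
apply: (@fsum_to_ex _ _ _ (fun i => nrm (f i) ^+ 2 + nrm (g i) ^+ 2) (B + D)).
  move=> i; apply: le_trans (dot_le _ _) _.
  by have := sqr_ge0 (nrm (f i) - nrm (g i)); have := nrm_ge0 (f i);
     have := nrm_ge0 (g i); nra.
by move=> E; rewrite big_split; exact: lerD.
Qed.

Definition l2dot (f g : l2) : C := sval (cid (l2dot_ex f g)).

Lemma l2dotP (f g : l2) : fsum_to (fun i => dotp (f i) (g i)) (l2dot f g).
Proof. exact: svalP (cid (l2dot_ex f g)). Qed.

Let l2dot_bilinear : bilinear_for *%R (Num.conj \; *%R) l2dot.
Proof.
split=> [g a f1 f2|f a g1 g2]; apply: (fsum_to_inj (l2dotP _ _)).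
  rewrite (_ : (fun i => _) = fun i => a * dotp (f1 i) (g i) + dotp (f2 i) (g i)).
    by apply: fsum_to_lin; exact: l2dotP.
  by apply/funext => i; rewrite l2_add l2_scale dotDl dotZl.
rewrite (_ : (fun i => _) =
    fun i => Num.conj a * dotp (f i) (g1 i) + dotp (f i) (g2 i)).
  by apply: fsum_to_lin; exact: l2dotP.
by apply/funext => i; rewrite l2_add l2_scale dotDr dotZr.
Qed.

HB.instance Definition _ :=
  @bilinear_isBilinear.Build C l2 l2 C *%R (Num.conj \; *%R) l2dot l2dot_bilinear.

Let l2dot_herm (f g : l2) : l2dot f g = (-1) ^+ false * Num.conj (l2dot g f).
Proof.
rewrite expr0 mul1r; apply: (fsum_to_inj (l2dotP _ _)).
rewrite (_ : (fun i => _) = fun i => Num.conj (dotp (g i) (f i))).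
  by apply: fsum_to_conj; exact: l2dotP.
by apply/funext => i; rewrite dotC.
Qed.

HB.instance Definition _ :=
  @isHermitianSesquilinear.Build C l2 false Num.conj l2dot l2dot_herm.

Lemma l2dot_linl a f1 f2 g :
  l2dot (a *: f1 + f2) g = a * l2dot f1 g + l2dot f2 g.
Proof. exact: l2dot_bilinear.1. Qed.

Lemma l2dot_linr a f g1 g2 :
  l2dot f (a *: g1 + g2) = Num.conj a * l2dot f g1 + l2dot f g2.
Proof. exact: l2dot_bilinear.2. Qed.

Lemma l2dot_sqr (f : l2) : fsum_to (fun i => (nrm (f i) ^+ 2)%:C) (l2dot f f).
Proof.
rewrite (_ : (fun i => _) = fun i => dotp (f i) (f i)); first exact: l2dotP.
by apply/funext => i; rewrite dot_nrm.
Qed.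

Lemma l2dot_ge_sum (f : l2) (E : {fset I}) :
  \sum_(i <- E) nrm (f i) ^+ 2 <= complex.Re (l2dot f f).
Proof. by apply: fsum_to_Re_ge (l2dot_sqr f) => i; exact: sqr_ge0. Qed.

Lemma l2dot_le_sum (f : l2) B :
  (forall E : {fset I}, \sum_(i <- E) nrm (f i) ^+ 2 <= B) ->
  complex.Re (l2dot f f) <= B.
Proof. exact: fsum_to_Re_le (l2dot_sqr f). Qed.

Lemma l2dot_real (f : l2) : l2dot f f = (complex.Re (l2dot f f))%:C.
Proof.
have := l2dot_herm f f; rewrite expr0 mul1r; case: (l2dot f f) => a b [] bb.
by congr (_ +i* _); lra.
Qed.

Lemma l2dot_ge0 (f : l2) : 0 <= l2dot f f.
Proof.
by rewrite l2dot_real ler0c; have := l2dot_ge_sum f fset0; rewrite big_seq_fset0.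
Qed.

Let l2dot_pos (f : l2) : f != 0 -> 0 < l2dot f f.
Proof.
move=> f0; rewrite lt_neqAle l2dot_ge0 andbT eq_sym.
apply: contra f0 => /eqP f0; apply/eqP/l2_ext => i; apply: nrm0_eq0.
have := l2dot_ge_sum f [fset i]%fset; rewrite big_seq_fset1 f0 /= => h.
by apply/eqP; rewrite -sqrf_eq0 eq_le h sqr_ge0.
Qed.

HB.instance Definition _ := @isDotProduct.Build C l2 l2dot l2dot_pos.

Definition l2norm (f : l2) : R := Num.sqrt (complex.Re (l2dot f f)).

Lemma l2norm_ge0 f : 0 <= l2norm f. Proof. exact: sqrtr_ge0. Qed.

Lemma l2norm_sqr f : l2norm f ^+ 2 = complex.Re (l2dot f f).
Proof. by rewrite sqr_sqrtr // -ler0c -l2dot_real l2dot_ge0. Qed.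

Let l2normD f g : (l2norm (f + g))%:C <= (l2norm f)%:C + (l2norm g)%:C.
Proof.
rewrite -rmorphD lecR /= -(@ler_pXn2r _ 2) ?nnegrE ?addr_ge0 ?l2norm_ge0 //.
have E z : l2dot (f + z *: g) (f + z *: g) = l2dot f f + Num.conj z * l2dot f g +
    z * l2dot g f + z * Num.conj z * l2dot g g.
  by rewrite addrC l2dot_linl !l2dot_linr; ring.
have [_] : l2dot g f = Num.conj (l2dot f g) /\
    cabs (l2dot f g) ^+ 2 <= complex.Re (l2dot f f) * complex.Re (l2dot g g).
  by apply: psd_cross (l2dot_ge0 g) _ => z; rewrite -E l2dot_ge0.
rewrite -!l2norm_sqr -exprMn => h2.
have h : cabs (l2dot f g) <= l2norm f * l2norm g.
  by rewrite -(@ler_pXn2r _ 2) ?nnegrE ?mulr_ge0 ?l2norm_ge0 ?cabs_ge0.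
rewrite sqrrD ![_ ^+ 2]l2norm_sqr.
have := E 1; rewrite scale1r => ->.
have := l2dot_herm g f; rewrite expr0 mul1r => ->.
move: h; have := cabs_Re (l2dot f g); have := ler_norm (complex.Re (l2dot f g)).
rewrite !raddfD /=; case: (l2dot f g) => a b /=.
rewrite conjC1 !mul1r /=; lra.
Qed.

Let l2normZ a f : (l2norm (a *: f))%:C = `|a| * (l2norm f)%:C.
Proof.
rewrite cabsE -rmorphM; congr (_%:C); apply/eqP => /=.
rewrite -(@eqrXn2 _ 2) ?l2norm_ge0 ?mulr_ge0 ?cabs_ge0 ?l2norm_ge0 //.
rewrite exprMn !l2norm_sqr -[a *: f]addr0 l2dot_linl l2dot_linr.
rewrite [l2dot f 0]linear0r [l2dot 0 _]linear0l !addr0 mulrA mulcC_cabs.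
by rewrite l2dot_real -rmorphM.
Qed.

Let l2norm0_eq0 f : (l2norm f)%:C = 0 -> f = 0.
Proof.
case=> f0; apply/eqP; apply: contraT => /l2dot_pos.
by rewrite l2dot_real -l2norm_sqr f0 expr0n ltxx.
Qed.

HB.instance Definition _ :=
  @Lmodule_isNormed.Build C l2 (fun f => (l2norm f)%:C) l2normD l2normZ l2norm0_eq0.

Lemma l2nrm (f : l2) : nrm f = l2norm f.
Proof. by []. Qed.

Lemma l2nrm_ge_sum (f : l2) (E : {fset I}) :
  \sum_(i <- E) nrm (f i) ^+ 2 <= nrm f ^+ 2.
Proof. by rewrite l2nrm l2norm_sqr l2dot_ge_sum. Qed.

Lemma l2nrm_le_sum (f : l2) B : 0 <= B ->
  (forall E : {fset I}, \sum_(i <- E) nrm (f i) ^+ 2 <= B ^+ 2) -> nrm f <= B.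
Proof.
move=> B0 h; rewrite -(@ler_pXn2r _ 2) ?nnegrE ?nrm_ge0 //.
by rewrite l2nrm l2norm_sqr l2dot_le_sum.
Qed.

Lemma nrm_coord (f : l2) i : nrm (f i) <= nrm f.
Proof.
rewrite -(@ler_pXn2r _ 2) ?nnegrE ?nrm_ge0 //.
by have := l2nrm_ge_sum f [fset i]%fset; rewrite big_seq_fset1.
Qed.

(** The limit is taken coordinatewise. Its distance to a Cauchy approximant is
    controlled on each finite set of coordinates by a member of the filter that
    is close to the limit on these coordinates, with a bound that does not
    depend on the finite set. *)
Lemma l2_cauchy_cvg (F : set_system l2) : ProperFilter F -> cauchy F -> cvg F.
Proof.
move=> FF /cauchy_nrmP Fc; apply/cvg_ex.
have cv i : exists w : H, forall e u, 0 < e ->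
    F [set v : l2 | nrm (u - v i) <= e] -> nrm (u - w) <= e.
  have [||w hw] := @small_sets_cvg R H
      (fun e u => F [set v : l2 | nrm (u - v i) <= e]).
  - move=> e e0; have [u Fu] := Fc e e0; exists (u i).
    apply: filterS Fu => v /= /ltW; apply: le_trans.
    exact: (nrm_coord (u - v)).
  - move=> e d u v e0 d0 Fu Fv.
    have [x [/= ux vx]] := filter_ex (filterI Fu Fv).
    have := nrm_dist_trans u (x i) v; rewrite (nrmBC (x i) v).
    by move=> h; apply: le_trans h _; exact: lerD.
  by exists w.
have [f hf] := choice cv.
have close e u : 0 < e -> F [set v : l2 | nrm (u - v) < e] ->
    forall E : {fset I}, \sum_(i <- E) nrm (u i - f i) ^+ 2 <= (2 * e) ^+ 2.
  move=> e0 Fu E.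
  have [d d0 dE] : exists2 d : R, 0 < d & \sum_(i <- E) d ^+ 2 <= e ^+ 2.
    exists (e / (1 + (size E)%:R)).
      by rewrite divr_gt0 // ltr_wpDr.
    rewrite big_const_seq count_predT iter_addr addr0 -[leLHS]mulr_natl.
    have n0 : 0 <= (size E)%:R :> R by [].
    rewrite expr_div_n mulrA ler_pdivrMr ?exprn_gt0 ?ltr_wpDr //.
    by have := sqr_ge0 e; nra.
  have Fd i : F [set v : l2 | nrm (v i - f i) <= d].
    have d2 : 0 < d / 2 by rewrite divr_gt0.
    have [x Fx] := Fc _ d2.
    have xf : nrm (x i - f i) <= d / 2.
      apply: hf => //; apply: filterS Fx => v /= /ltW; apply: le_trans.
      exact: (nrm_coord (x - v)).
    apply: filterS Fx => v /= /ltW xv.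
    have := nrm_dist_trans (v i) (x i) (f i); rewrite (nrmBC (v i) (x i)).
    have : nrm (x i - v i) <= nrm (x - v) by exact: (nrm_coord (x - v)).
    lra.
  have FE (s : seq I) : F [set v : l2 | forall i, i \in s -> nrm (v i - f i) <= d].
    elim: s => [|i s IH]; first by apply: filterS filterT => v _ i.
    apply: filterS2 (Fd i) IH => v vi vs k; rewrite inE => /orP[/eqP -> //|]; exact: vs.
  have [v [/= uv vf]] := filter_ex (filterI Fu (FE E)).
  apply: le_trans (_ : \sum_(i <- E) (2 * nrm ((u - v) i) ^+ 2 + 2 * d ^+ 2) <= _).
    rewrite [leLHS]big_seq [leRHS]big_seq; apply: ler_sum => i iE.
    have := parallelogram (u i - v i) (v i - f i).
    rewrite addrA subrK -/((u - v) i).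
    have := vf i iE; have := nrm_ge0 (v i - f i).
    have := sqr_ge0 (nrm (u i - v i - (v i - f i))).
    set x := nrm (v i - f i); set y := nrm _ ^+ 2; rewrite -/((u - v) i).
    by rewrite -[u i - v i]/((u - v) i); nra.
  rewrite big_split /= -[X in X + _]mulr_sumr -[X in _ + X]mulr_sumr.
  have := l2nrm_ge_sum (u - v) E.
  have : nrm (u - v) ^+ 2 <= e ^+ 2.
    by rewrite ler_pXn2r ?nnegrE ?nrm_ge0 ?ltW.
  lra.
have fS : f \in square_summable.
  have [u Fu] := Fc 1 ltr01.
  have -> : f = l2val u - (fun i => u i - f i).
    by apply/funext => i; rewrite -[RHS]/(u i - (u i - f i)) opprB addrC subrK.
  rewrite rpredB ?l2P //; apply/square_summableP; exists ((2 * 1) ^+ 2) => E.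
  exact: close Fu E.
exists (L2 fS); apply/cvg_nrmP => e e0.
have e4 : 0 < e / 4 by rewrite divr_gt0.
have [u Fu] := Fc _ e4.
have uf : nrm (u - L2 fS) <= 2 * (e / 4).
  apply: l2nrm_le_sum => [|E]; first by rewrite mulr_ge0 // ltW.
  exact: (close _ _ e4 Fu E).
apply: filterS Fu => v /= uv.
apply: le_lt_trans (nrm_dist_trans _ u _) _; rewrite nrmBC.
have -> : e = 2 * (e / 4) + 2 * (e / 4) by field.
apply: ler_ltD uf (lt_trans uv _); rewrite ltr_pMl // ltr1n //.
Qed.

HB.instance Definition _ := Uniform_isComplete.Build l2 l2_cauchy_cvg.

Let l2dot_norm (f : l2) : `|f| ^+ 2 = l2dot f f.
Proof. by rewrite nrmE -rmorphXn /= l2nrm l2norm_sqr -l2dot_real. Qed.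

HB.instance Definition _ := @NormedModule_hasDot.Build R l2 l2dot l2dot_norm.

Lemma l2_dotp (f g : l2) : fsum_to (fun i => dotp (f i) (g i)) (dotp f g).
Proof. exact: l2dotP. Qed.

End SquareSummable.

(** * Coordinates and tensor products of square-summable families *)

Section SquareSummableTheory.
Context {R : realType}.
Local Notation C := R[i].

Section Coordinates.
Variables (I : choiceType) (H : hilbertType R).
Local Notation L := (l2 I H).

Lemma fsum_to_single (F : I -> C) i :
  (forall j, j != i -> F j = 0) -> fsum_to F (F i).
Proof.
move=> F0 e e0; exists [fset i]%fset => E; rewrite fsub1set => iE.
rewrite (big_fsetD1 _ iE) /= big1_fset ?addr0 ?subrr ?cabs0 1?ltW // => j.
by rewrite !inE => /andP[ji _] _; exact: F0.
Qed.

Lemma l2_dotE (f g : L) s :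
  fsum_to (fun i => dotp (f i) (g i)) s -> dotp f g = s.
Proof. exact: fsum_to_inj (l2_dotp f g). Qed.

Lemma single_summable i (h : H) :
  (fun j => if j == i then h else 0) \in @square_summable R I H.
Proof.
apply/square_summableP; exists (nrm h ^+ 2) => E.
have [iE|iE] := boolP (i \in E).
  rewrite (big_fsetD1 _ iE) /= eqxx big1_fset ?addr0 // => j.
  by rewrite !inE => /andP[/negbTE -> _] _; rewrite nrm0 expr0n.
rewrite big1_fset ?sqr_ge0 // => j jE _; case: eqP => [ji|_].
  by rewrite -ji jE in iE.
by rewrite nrm0 expr0n.
Qed.

Definition single i (h : H) : L := L2 (single_summable i h).

Lemma singleE i h j : single i h j = if j == i then h else 0.
Proof. by []. Qed.

Lemma single_linear i : linear (single i).
Proof.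
move=> a u v; apply: l2_ext => j; rewrite l2_add l2_scale !singleE.
by case: eqP => // _; rewrite scaler0 addr0.
Qed.

Lemma dot_single i h (f : L) : dotp (single i h) f = dotp h (f i).
Proof.
apply: l2_dotE; pose F j := dotp (single i h j) (f j).
have -> : dotp h (f i) = F i by rewrite /F singleE eqxx.
apply: fsum_to_single => j ji.
by rewrite /F singleE (negbTE ji) dot0l.
Qed.

Lemma dot_single_r i h (f : L) : dotp f (single i h) = dotp (f i) h.
Proof. by rewrite dotC dot_single -dotC. Qed.

Lemma nrm_single i h : nrm (single i h) = nrm h.
Proof.
apply/eqP; rewrite -(@eqrXn2 _ 2) ?nrm_ge0 // !nrm_sqr dot_single.
by rewrite singleE eqxx.
Qed.

Lemma single_bounded i : bounded_map (single i).
Proof.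
by split; [exact: single_linear|exists 1 => // u; rewrite mul1r nrm_single].
Qed.

Lemma coord_bounded i : bounded_map (fun f : L => f i).
Proof.
split=> [a f g|]; first by rewrite l2_add l2_scale.
by exists 1 => // f; rewrite mul1r nrm_coord.
Qed.

Definition trunc (E : {fset I}) (f : L) : L := \sum_(i <- E) single i (f i).

Lemma l2_sum (J : Type) (s : seq J) (F : J -> L) i :
  (\sum_(j <- s) F j) i = \sum_(j <- s) F j i.
Proof. by elim: s => [|j s IH]; rewrite ?big_nil // !big_cons l2_add IH. Qed.

Lemma truncE E f i : trunc E f i = if i \in E then f i else 0.
Proof.
rewrite /trunc l2_sum; case: ifP => iE.
  rewrite (big_fsetD1 _ iE) /= eqxx big1_fset ?addr0 // => j.
  by rewrite !inE => /andP[ji _] _; rewrite /= eq_sym (negbTE ji).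
rewrite big1_fset // => j jE _ /=; case: eqP => // ij.
by rewrite ij jE in iE.
Qed.

Lemma nrm_trunc E f : nrm (trunc E f) <= nrm f.
Proof.
apply: l2nrm_le_sum => [|E']; first exact: nrm_ge0.
apply: le_trans (l2nrm_ge_sum f E'); apply: ler_sum => i _; rewrite truncE.
by case: ifP => // _; rewrite nrm0 expr0n sqr_ge0.
Qed.

Lemma trunc_cvg f e : 0 < e -> exists E0 : {fset I},
  forall E : {fset I}, (E0 `<=` E)%fset -> nrm (f - trunc E f) <= e.
Proof.
move=> e0; have e2 : 0 < e ^+ 2 by rewrite exprn_gt0.
have hf : fsum_to (fun i => (nrm (f i) ^+ 2)%:C) (dotp f f).
  have := l2_dotp f f; congr fsum_to; apply/funext => i; exact: dot_nrm.
have [E0 hE0] := hf _ e2; exists E0 => E sE.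
apply: l2nrm_le_sum => [|E']; first exact: ltW.
have sE' := fsubset_trans sE (fsubsetUl E E').
have h1 : nrm f ^+ 2 - e ^+ 2 <= \sum_(i <- E) nrm (f i) ^+ 2.
  have := le_trans (cabs_Re _) (hE0 _ sE); rewrite -rmorph_sum raddfB /=.
  by rewrite -nrm_sqr ler_norml => /andP[]; lra.
have := l2nrm_ge_sum f (E `|` E')%fset.
rewrite (sum_fsetDK _ (fsubsetUl E E')).
have -> : \sum_(i <- E') nrm ((f - trunc E f) i) ^+ 2 =
    \sum_(i <- ((E `|` E') `\` E)%fset) nrm (f i) ^+ 2.
  have tE i : (f - trunc E f) i = if i \in E then 0 else f i.
    by rewrite l2_add l2_opp truncE; case: ifP; rewrite ?subrr ?subr0.
  under eq_bigr do rewrite tE.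
  rewrite (big_fsetID _ (mem E)) /= [X in X + _]big1_fset ?add0r; last first.
    move=> i; rewrite !inE /= => /andP[_ iE] _; by rewrite iE nrm0 expr0n.
  apply: eq_fbig => [i|i]; first by rewrite !inE; case: (i \in E); case: (i \in E').
  by rewrite !inE /= => /andP[_ /negbTE ->].
by move: h1; set x := \sum_(i <- E) _; set y := \sum_(i <- _) _; lra.
Qed.

End Coordinates.

Section Tensor.
Variables (I : choiceType) (H : hilbertType R).
Local Notation K := (l2 I (cline R)).
Local Notation L := (l2 I H).

Lemma cline_dotE (a b : cline R) : dotp a b = (a : C) * Num.conj (b : C).
Proof. by []. Qed.

Lemma l2tensor_summable (h : H) (k : K) :
  (fun i => (k i : C) *: h) \in @square_summable R I H.
Proof.
apply/square_summableP; exists (nrm k ^+ 2 * nrm h ^+ 2) => E.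
under eq_bigr do rewrite nrmZ exprMn.
rewrite -mulr_suml ler_wpM2r ?sqr_ge0 //; exact: (l2nrm_ge_sum k).
Qed.

(** The tensor product of [H] with a space of scalar families is the space of
    [H]-valued families, [h (x) k] being [k i *: h] at [i]. *)
Definition l2tensor (h : H) (k : K) : L := L2 (l2tensor_summable h k).

Lemma l2tensorE h k i : l2tensor h k i = (k i : C) *: h. Proof. by []. Qed.

Let l2tensor_bilinear : bilinear_for *:%R *:%R l2tensor.
Proof.
split=> [k a u v|u a k l]; apply: l2_ext => i; rewrite l2_add l2_scale !l2tensorE.
  by rewrite scalerDr !scalerA mulrC.
have -> : ((a *: k + l) i : C) = a * (k i : C) + (l i : C) by [].
by rewrite scalerDl -scalerA.
Qed.

HB.instance Definition _ := @bilinear_isBilinear.Build C H K L *:%R *:%R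
  l2tensor l2tensor_bilinear.

Lemma l2tensor_dot u v k l :
  dotp (l2tensor u k) (l2tensor v l) = dotp u v * dotp k l.
Proof.
apply: l2_dotE; rewrite mulrC -[_ * _]addr0 (_ : (fun i => _) =
  fun i => dotp u v * dotp (k i) (l i) + 0).
  rewrite mulrC; apply: fsum_to_lin (l2_dotp k l) _ => e e0.
  by exists fset0 => E _; rewrite big1 // subrr cabs0 ltW.
apply/funext => i; rewrite !l2tensorE dotZl dotZr cline_dotE addr0 mulrA.
by rewrite mulrC.
Qed.

Definition unit_vec (i : I) : K := single i (1 : cline R).

Lemma l2tensor_unit h i : l2tensor h (unit_vec i) = single i h.
Proof.
apply: l2_ext => j; rewrite l2tensorE !singleE; case: eqP => _.
  by rewrite scale1r.
by rewrite scale0r.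
Qed.

Lemma lin_span_sum (V : lmodType C) (J : Type) (E : set V) (s : seq J) (F : J -> V) :
  (forall j, E (F j)) -> lin_span E (\sum_(j <- s) F j).
Proof.
move=> EF; exists (size s), (fun=> 1), (fun i => F (tnth (in_tuple s) i)).
by split=> //; rewrite big_tnth; apply: eq_bigr => i _; rewrite scale1r.
Qed.

Lemma l2tensor_dense :
  closure (lin_span [set w : L | exists u k, w = l2tensor u k]) = setT.
Proof.
apply/seteqP; split=> // f _; apply/closure_nrmP => e e0.
have e2 : 0 < e / 2 by rewrite divr_gt0.
have [E hE] := trunc_cvg f e2; exists (trunc E f); last first.
  by apply: le_lt_trans (hE _ (fsubset_refl E)) _; lra.
by apply: lin_span_sum => i; exists (f i), (unit_vec i); rewrite l2tensor_unit.
Qed.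

Definition l2_tensor : hilbert_tensor H K :=
  @HilbertTensor R H K L l2tensor l2tensor_dot l2tensor_dense.

End Tensor.
End SquareSummableTheory.

(** * Strong closure and the bicommutant theorem *)

Section StrongClosure.
Context {R : realType} {H : hilbertType R}.
Local Notation C := R[i].
Implicit Types (x y : H -> H) (M : set (H -> H)).

Definition strongly_near M x := forall (s : seq H) (e : R), 0 < e ->
  exists2 y, M y & forall u, u \in s -> nrm (x u - y u) <= e.

(** The topology of pointwise convergence has the finite intersections of
    conditions at single vectors as neighbourhoods. *)
Lemma closure_ptwsP M x :
  closure (M : set {ptws H -> H}) x <-> strongly_near M x.
Proof.
split=> [clx s e e0|nx].
  pose B : set {ptws H -> H} := [set y | forall u, u \in s -> nrm (x u - y u) <= e].
  suff /clx[y [My By]] : nbhs (x : {ptws H -> H}) B by exists y.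
  have B1 u : nbhs (x : {ptws H -> H}) [set y | nrm (x u - y u) <= e].
    have := @proj_continuous H (fun=> H) u (x : {ptws H -> H}).
    move=> /(_ [set v | nrm (x u - v) <= e]); apply.
    by apply/nbhs_nrmP; exists e => // v /ltW.
  have Fx := @nbhs_filter {ptws H -> H} x.
  rewrite /B; elim: s {B} => [|u s IH].
    by apply: (@filterS _ _ Fx setT) => [y _ v //|]; exact: (@filterT _ _ Fx).
  apply: (@filterS2 _ _ Fx _ _ _ _ (B1 u) IH) => y hu hs v.
  by rewrite inE => /orP[/eqP -> //|]; exact: hs.
rewrite closureEcvg.
pose D := [set p : seq H * R | 0 < p.2].
pose b (p : seq H * R) := [set y | M y /\ forall u, u \in p.1 -> nrm (x u - y u) <= p.2].
pose F : set_system (H -> H) := filter_from D b.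
have FF : ProperFilter F.
  apply: filter_from_proper; last first.
    by move=> [s e] /= e0; have [y My hy] := nx s e e0; exists y.
  apply: filter_from_filter; first by exists ([::], 1); exact: ltr01.
  move=> [s e] [t d] /= e0 d0; exists (s ++ t, Num.min e d).
    by rewrite /D /= lt_min e0 d0.
  move=> y [/= My hy]; split; split=> // u us /=; have := hy u;
    by rewrite mem_cat us ?orbT => /(_ isT); rewrite le_min => /andP[].
exists F => //; split.
  apply/(@pointwise_cvgP H H F x) => u; apply/cvg_nrmP => e e0.
  exists ([:: u], e / 2); first by rewrite /D /= divr_gt0.
  move=> y [_ /= hy]; apply: le_lt_trans (hy u (mem_head _ _)) _; lra.
move=> B BM; exists ([::], 1); first exact: ltr01.
by move=> y [/BM].
Qed.

Lemma strong_closureP M x :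
  strong_closure M x <-> bounded_map x /\ strongly_near M x.
Proof.
split=> [[/bounded_opP bx /closure_ptwsP nx]|[/bounded_opP bx /closure_ptwsP nx]];
  by split.
Qed.

Lemma strongly_near_trans M x :
  strongly_near (strong_closure M) x -> strongly_near M x.
Proof.
move=> hx s e e0; have e2 : 0 < e / 2 by rewrite divr_gt0.
have [y /strong_closureP[_ hy] xy] := hx s _ e2.
have [z Mz yz] := hy s _ e2; exists z => // u us.
exact: nrm_dist_half (xy u us) (yz u us).
Qed.

End StrongClosure.

Section Bicommutant.
Context {R : realType} {H : hilbertType R}.
Local Notation C := R[i].
Implicit Types (b x : H -> H) (M : set (H -> H)).

Section Amplification.
Variable I : choiceType.
Local Notation L := (l2 I H).

(** The operator [x (x) 1] on families, with the junk value [0] where the image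
    family is not square-summable, so that it takes no proof as argument. *)
Definition amplify x (f : L) : L := insubd 0 (fun i => x (f i)).

Lemma amplifyE x f i : bounded_map x -> amplify x f i = x (f i).
Proof.
move=> [_ [B B0 xB]]; rewrite /amplify -[l2val _]/(val _) val_insubd ifT //.
apply/square_summableP; exists (B ^+ 2 * nrm f ^+ 2) => E.
apply: le_trans (ler_wpM2l (sqr_ge0 B) (l2nrm_ge_sum f E)).
rewrite mulr_sumr; apply: ler_sum => j _; rewrite -exprMn.
by rewrite ler_pXn2r ?nnegrE ?nrm_ge0 ?mulr_ge0 ?nrm_ge0.
Qed.

Lemma amplify_bounded x : bounded_map x -> bounded_map (amplify x).
Proof.
move=> bx; case: (bx) => lx [B B0 xB]; split=> [a f g|].
  by apply: l2_ext => i; rewrite l2_add l2_scale !amplifyE // l2_add l2_scale lx.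
exists B => // f; apply: l2nrm_le_sum => [|E]; first by rewrite mulr_ge0 // nrm_ge0.
rewrite exprMn; apply: le_trans (ler_wpM2l (sqr_ge0 B) (l2nrm_ge_sum f E)).
rewrite mulr_sumr; apply: ler_sum => i _; rewrite -exprMn amplifyE //.
by rewrite ler_pXn2r ?nnegrE ?nrm_ge0 ?mulr_ge0 ?nrm_ge0.
Qed.

Lemma amplify_adjoint x y : bounded_map x -> bounded_map y ->
  is_adjoint x y -> is_adjoint (amplify x) (amplify y).
Proof.
move=> bx by_ xy f g; apply: l2_dotE.
rewrite (_ : (fun i => _) = fun i => dotp (f i) (amplify y g i)).
  exact: l2_dotp.
by apply/funext => i; rewrite !amplifyE.
Qed.

Lemma amplify_single x i h : bounded_map x ->
  amplify x (single i h) = single i (x h).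
Proof.
move=> bx; apply: l2_ext => j; rewrite amplifyE // !singleE.
by case: eqP => // _; rewrite (lin0 (proj1 bx)).
Qed.

End Amplification.

Section FiniteFamilies.
Variable I : finType.
Local Notation L := (l2 I H).

Lemma tuple_summable (f : I -> H) : f \in @square_summable R I H.
Proof.
apply/square_summableP; exists (\sum_(i <- [fset i | i in I]%fset) nrm (f i) ^+ 2).
move=> E; apply: ler_sum_fset => [i|]; first exact: sqr_ge0.
by apply/fsubsetP => i _; rewrite !inE.
Qed.

Definition tuple_vec (f : I -> H) : L := L2 (tuple_summable f).

Lemma sum_single (f : L) : f = \sum_(i : I) single i (f i).
Proof.
apply: l2_ext => i; rewrite l2_sum (bigD1 i) //= eqxx big1 ?addr0 // => j ji.
by rewrite /= eq_sym (negbTE ji).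
Qed.

End FiniteFamilies.

Lemma orth_proj_commute (W : hilbertType R) (N : set W) (cN : closed_subspace N)
    (y z : W -> W) : bounded_map y -> is_adjoint y z ->
  (forall u, N u -> N (y u)) -> (forall u, N u -> N (z u)) ->
  forall u, orth_proj cN (y u) = y (orth_proj cN u).
Proof.
move=> [ly _] yz yN zN u; apply: orth_proj_unique => [|v Nv].
  by apply: yN; exact: orth_projM.
rewrite -(linB ly) dotC yz -dotC; apply: orth_proj_perp; exact: zN.
Qed.

Definition commutant M : set (H -> H) :=
  [set x | bounded_map x /\ forall b, M b -> forall u, x (b u) = b (x u)].

Section Density.
Variable M : set (H -> H).
Hypothesis vM : von_neumann_algebra M.

Lemma vna_bounded_map b : M b -> bounded_map b.
Proof. by move=> /(vna_bounded vM)/bounded_opP. Qed.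

Lemma vna_adjoint_ex b : M b -> exists2 c, M c & is_adjoint b c.
Proof.
move=> Mb; have [c bc adj] := adjoint_ex (vna_bounded_map Mb).
by exists c => //; apply: vna_adjoint Mb _ adj => //; apply/bounded_opP.
Qed.

Lemma vna_strong x : bounded_map x -> strongly_near M x -> M x.
Proof. by move=> bx nx; rewrite -(vna_closed vM); apply/strong_closureP. Qed.

Lemma is_adjoint_sym x y : is_adjoint x y -> is_adjoint y x.
Proof. by move=> xy u v; rewrite dotC -xy -dotC. Qed.

Lemma commutant_adjoint y z : commutant M y -> bounded_map z -> is_adjoint y z ->
  commutant M z.
Proof.
move=> [by_ yc] bz yz; split=> // b Mb u; have [c Mc bc] := vna_adjoint_ex Mb.
by apply: dot_inj => w; rewrite -yz -!(is_adjoint_sym bc) -yz yc.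
Qed.

Section Orbit.
Variables (I : finType) (xi : l2 I H).

Let orbit : set (l2 I H) := [set amplify b xi | b in M].
Let N := closed_span orbit.
Let cN : closed_subspace N := closed_span_closed orbit.

Let orbit_approx f : N f ->
  forall e, 0 < e -> exists2 b, M b & nrm (f - amplify b xi) <= e.
Proof.
move=> Nf; apply: (Nf [set f | forall e, 0 < e ->
    exists2 b, M b & nrm (f - amplify b xi) <= e]); last first.
  move=> _ [b Mb <-] e e0; exists b => //.
  by rewrite subrr nrm0 ltW.
split=> [e e0|a f1 g hf hg e e0|f1 hf e e0].
- exists 0; first exact: vna_zero vM.
  have -> : amplify 0 xi = 0.
    by apply: l2_ext => i; rewrite amplifyE //; exact: bounded_map_0.
  by rewrite subrr nrm0 ltW.
- have na := cabs_ge0 a.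
  have [d d0 de] := eps_div na e0.
  have [b Mb fb] := hf _ d0; have [c Mc gc] := hg _ d0.
  exists (a *: b + c); first exact: vna_linear vM _ _ _ Mb Mc.
  have -> : amplify (a *: b + c) xi = a *: amplify b xi + amplify c xi.
    have [bb bc] := (vna_bounded_map Mb, vna_bounded_map Mc).
    apply: l2_ext => i; rewrite l2_add l2_scale !amplifyE //.
    exact: bounded_map_lin.
  rewrite opprD addrACA -scalerBr (le_trans (nrmD _ _)) // nrmZ -/(cabs a); nra.
- have e2 : 0 < e / 2 by rewrite divr_gt0.
  have [g hg fg] := hf _ e2; have [b Mb gb] := hg _ e2; exists b => //.
  exact: nrm_dist_half fg gb.
Qed.

Let orbit_stable b : M b -> forall f, N f -> N (amplify b f).
Proof.
move=> Mb f Nf; have bb := amplify_bounded I (vna_bounded_map Mb).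
apply: (Nf [set f | N (amplify b f)]); last first.
  move=> _ [c Mc <-]; apply: sub_closed_span; exists (b \o c).
    exact: vna_comp vM _ _ Mb Mc.
  have [bb' bc] := (vna_bounded_map Mb, vna_bounded_map Mc).
  by apply: l2_ext => i; rewrite !amplifyE //; exact: bounded_map_comp.
split=> [|a g h /= Ng Nh|g hg]; first by rewrite /= (lin0 (proj1 bb)); exact: csub0 cN.
  by rewrite /= (proj1 bb); apply: (csubD cN) => //; exact: (csubZ cN).
case: (cN) => _ _; apply => e e0; case: bb => lb [B B0 bB].
have [d d0 de] := eps_div B0 e0.
have [h Nh gh] := hg _ d0; exists (amplify b h) => //.
rewrite -(linB lb); apply: le_trans (bB _) _.
by have := nrm_ge0 (g - h); nra.
Qed.

Let orth_proj_orbit b : M b -> forall f, orth_proj cN (amplify b f) = amplify b (orth_proj cN f).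
Proof.
move=> Mb; have [c Mc bc] := vna_adjoint_ex Mb.
have [bb bc'] := (vna_bounded_map Mb, vna_bounded_map Mc).
apply: orth_proj_commute (amplify_adjoint bb bc' bc) _ _; try exact: orbit_stable.
exact: amplify_bounded.
Qed.

(** The part of [xi] orthogonal to its orbit is killed by the whole algebra,
    and non-degeneracy leaves only zero for it. *)
Let orbit_self : N xi.
Proof.
pose eta := xi - orth_proj cN xi.
suff eta0 : eta = 0.
  by rewrite -[xi](subrK (orth_proj cN xi)) -/eta eta0 add0r; exact: orth_projM.
have kill b i : M b -> b (eta i) = 0.
  move=> Mb; have bb := amplify_bounded I (vna_bounded_map Mb).
  rewrite -(amplifyE _ _ (vna_bounded_map Mb)).
  rewrite /eta (linB (proj1 bb)) -orth_proj_orbit // orth_proj_id ?subrr //.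
  by apply: sub_closed_span; exists b.
apply: l2_ext => i; apply: dot_eq0 => u.
have : closure (lin_span [set v : H | exists x u, M x /\ v = x u]) u.
  by rewrite (vna_nondegenerate vM).
move=> /closure_nrmP hu; have ne := nrm_ge0 (eta i).
apply: cabs_le_eq0 => e e0.
have [d d0 de] := eps_div ne e0.
have [v [n [a [w [Mw vE]]]] uv] := hu _ d0.
have v0 : dotp v (eta i) = 0.
  rewrite vE dot_suml big1 // => k _; rewrite dotZl.
  have [x [t [Mx ->]]] := Mw k; have [y My xy] := vna_adjoint_ex Mx.
  by rewrite xy kill // dot0r mulr0.
have -> : dotp u (eta i) = dotp (u - v) (eta i) by rewrite dotBl v0 subr0.
apply: le_trans (dot_le _ _) _.
by have := nrm_ge0 (u - v); nra.
Qed.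

(** The projection on the closed orbit of [xi] commutes with the amplified
    algebra, so its entries lie in the commutant. An operator [x] commuting with
    these entries then preserves the closed orbit, which contains [xi]. *)
Lemma bicommutant_approx x : bounded_map x ->
  (forall y, commutant M y -> forall u, x (y u) = y (x u)) ->
  forall e, 0 < e -> exists2 b, M b & nrm (amplify x xi - amplify b xi) <= e.
Proof.
move=> bx xc; apply: orbit_approx.
have bax := amplify_bounded I bx.
suff <- : orth_proj cN (amplify x xi) = amplify x xi by exact: orth_projM.
rewrite -{2}[xi](orth_proj_id cN orbit_self).
have bp := orth_proj_bounded cN.
pose p i j h := orth_proj cN (single j h) i.
have pc i j : commutant M (p i j).
  split.
    exact: bounded_map_comp (coord_bounded _ i) (bounded_map_comp bp (single_bounded _ j)).
  move=> b Mb u; rewrite /p.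
  have bb := vna_bounded_map Mb.
  by rewrite -(amplify_single _ _ bb) orth_proj_orbit // amplifyE.
have pE (f : l2 I H) i : orth_proj cN f i = \sum_j p i j (f j).
  by rewrite {1}[f]sum_single (lin_sum (proj1 bp)) l2_sum.
apply: l2_ext => i; rewrite pE amplifyE // pE (lin_sum (proj1 bx)).
by apply: eq_bigr => j _; rewrite amplifyE // xc.
Qed.

End Orbit.

(** Strong approximation at finitely many vectors is norm approximation at the
    single vector of the amplified space that lists them. *)
Lemma bicommutant x : bounded_map x ->
  (forall y, commutant M y -> forall u, x (y u) = y (x u)) -> M x.
Proof.
move=> bx xc; apply: vna_strong => // s e e0.
pose xi := tuple_vec (fun i : 'I_(size s) => tnth (in_tuple s) i).
have [b Mb xb] := bicommutant_approx xi bx xc e0; exists b => // u us.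
have /tnthP[i ->] : u \in in_tuple s by [].
apply: le_trans xb; have bb := vna_bounded_map Mb.
have := nrm_coord (amplify x xi - amplify b xi) i.
by rewrite l2_add l2_opp !amplifyE.
Qed.

Lemma vna_id : M idfun.
Proof. by apply: bicommutant => //; exact: bounded_map_id. Qed.

End Density.
End Bicommutant.

(** * Suprema of directed sets of operators *)

Section DirectedSuprema.
Context {R : realType} {H : hilbertType R}.
Local Notation C := R[i].
Implicit Types (d x y z : H -> H) (D N : set (H -> H)).

Definition qform x u : R := complex.Re (dotp (x u) u).

Lemma op_leP x y : op_le x y <-> forall u,
  complex.Im (dotp (x u) u) = complex.Im (dotp (y u) u) /\ qform x u <= qform y u.
Proof.
have E u : (0 <= dotp ((y - x) u) u) =
    (complex.Im (dotp (x u) u) == complex.Im (dotp (y u) u)) && (qform x u <= qform y u).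
  rewrite fun_addE fun_oppE dotBl /qform.
  case: (dotp (y u) u) (dotp (x u) u) => [a b] [c d]; rewrite lecE /=.
  rewrite subr_ge0; congr (_ && _).
  by apply/eqP/eqP => h; lra.
split=> h u; first by have := h u; rewrite E => /andP[/eqP].
by rewrite E; have [-> ->] := h u; rewrite eqxx.
Qed.

Lemma op_le_refl x : op_le x x.
Proof. by apply/op_leP. Qed.

Lemma op_le_trans y x z : op_le x y -> op_le y z -> op_le x z.
Proof.
move=> /op_leP xy /op_leP yz; apply/op_leP => u.
have [-> h1] := xy u; have [-> h2] := yz u; split=> //; exact: le_trans h1 h2.
Qed.

Lemma qform_le x y u : op_le x y -> qform x u <= qform y u.
Proof. by move=> /op_leP /(_ u)[]. Qed.

Lemma qformB x y u : qform (x - y) u = qform x u - qform y u.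
Proof. by rewrite /qform fun_addE fun_oppE dotBl raddfB. Qed.

Lemma qform_bound x B u : 0 <= B -> (forall v, nrm (x v) <= B * nrm v) ->
  qform x u <= B * nrm u ^+ 2.
Proof.
move=> B0 xB; apply: le_trans (ler_norm _) _; apply: le_trans (cabs_Re _) _.
by apply: le_trans (dot_le _ _) _; rewrite expr2 mulrA ler_wpM2r ?nrm_ge0.
Qed.

Lemma qform_ge0 x u : positive_op x -> 0 <= qform x u.
Proof. by move=> /(_ u); rewrite lecE => /andP[]. Qed.

Lemma bounded_mapB (V W : normedModType C) (f g : V -> W) :
  bounded_map f -> bounded_map g -> bounded_map (f - g).
Proof.
move=> bf bg; have -> : f - g = -1 *: g + f by rewrite scaleN1r addrC.
exact: bounded_map_lin.
Qed.

Section Positive.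
Variable p : H -> H.
Hypotheses (lp : linear p) (pp : positive_op p).

Lemma qform_parallelogram u v :
  qform p (u + v) + qform p (u - v) = 2 * qform p u + 2 * qform p v.
Proof.
rewrite /qform (linD lp) (linB lp) !(dotBl, dotDl, dotBr, dotDr) !(raddfD, raddfB) /=.
ring.
Qed.

Lemma qformD_le u v : qform p (u + v) <= 2 * qform p u + 2 * qform p v.
Proof. by rewrite -qform_parallelogram lerDl qform_ge0. Qed.

Lemma qformZ a u : qform p (a *: u) = cabs a ^+ 2 * qform p u.
Proof.
rewrite /qform (linZ lp) dotZl dotZr mulrA mulcC_cabs.
by case: (dotp _ _) => x y /=; rewrite mul0r subr0.
Qed.

Lemma positive_cauchy u v : cabs (dotp (p u) v) ^+ 2 <= qform p u * qform p v.
Proof.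
have [//|z|_] := @psd_cross R (dotp (p u) u) (dotp (p v) v) (dotp (p u) v) (dotp (p v) u).
  have := pp (u + z *: v); rewrite (linD lp) (linZ lp).
  by rewrite !dotDl !dotDr !dotZl !dotZr !mulrA !addrA.
by [].
Qed.

(** Cauchy-Schwarz for the form of [p], at [u] and [p u]. *)
Lemma positive_nrm B u : 0 <= B -> (forall v, qform p v <= B * nrm v ^+ 2) ->
  nrm (p u) ^+ 2 <= B * qform p u.
Proof.
move=> B0 pB; have := positive_cauchy u (p u).
rewrite dot_nrm cabsR ger0_norm ?sqr_ge0 //; have qu := qform_ge0 u pp.
have := ler_wpM2l qu (pB (p u)).
have [->|n0] := eqVneq (nrm (p u)) 0.
  by move=> _ _; rewrite expr0n mulr_ge0.
have x0 : 0 < nrm (p u) ^+ 2 by rewrite exprn_gt0 // lt_neqAle eq_sym n0 nrm_ge0.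
move=> h1 h2; have := le_trans h2 h1.
by rewrite mulrA expr2 ler_pM2r // [_ * B]mulrC.
Qed.

End Positive.

Definition weak_sup D x := (forall d, D d -> op_le d x) /\
  forall u e, 0 < e -> exists2 d, D d & qform x u - qform d u <= e.

(** Vigier's theorem: a bounded directed set of self-adjoint operators has a
    supremum, to which it converges pointwise. For [d0 <= d <= f] the bound
    [|(f - d) u|^2 <= B <(f - d) u, u>] turns the convergence of the numbers
    [<d u, u>] into a Cauchy property of the vectors [d u]. *)
Lemma vigier D z : bounded_map z -> (forall d, D d -> bounded_map d) ->
  D `<=` selfadjoint -> directed op_le D -> (forall d, D d -> op_le d z) ->
  exists y, [/\ bounded_map y, strongly_near D y & weak_sup D y].
Proof.
move=> bz bD sD [[d0 Dd0] dirD] Dz.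
(* Restricting to [d0 <= d] makes all differences uniformly bounded. *)
have [_ [B B0 zB]] := bounded_mapB bz (bD _ Dd0).
have gap d f u : D d -> D f -> op_le d0 d -> op_le d f ->
    nrm (f u - d u) ^+ 2 <= B * (qform f u - qform d u).
  move=> Dd Df d0d df; rewrite -qformB.
  have [lfd _] := bounded_mapB (bD _ Df) (bD _ Dd).
  apply: (@positive_nrm (f - d)) => // v.
  apply: le_trans (qform_bound v B0 zB); rewrite !qformB.
  by have := qform_le v (Dz _ Df); have := qform_le v d0d; lra.
have cv u : exists w, forall e, 0 < e -> exists2 d, D d &
    forall f, D f -> op_le d f -> nrm (f u - w) <= e.
  pose Q := [set qform d u | d in D].
  have hQ : has_sup Q.
    split; first by exists (qform d0 u), d0.
    by exists (qform z u) => _ [d Dd <-]; apply: qform_le; exact: Dz.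
  have tail e : 0 < e -> exists2 d, D d &
      forall f, D f -> op_le d f -> nrm (f u - d u) <= e.
    move=> e0; have e2 : 0 < e ^+ 2 by rewrite exprn_gt0.
    have [c c0 ce] := eps_div B0 e2.
    have [_ [d1 Dd1 <-] h1] := sup_adherent c0 hQ.
    have [d [Dd d0d d1d]] := dirD _ _ Dd0 Dd1.
    exists d => // f Df df.
    rewrite -(@ler_pXn2r _ 2) ?nnegrE ?nrm_ge0 ?(ltW e0) //.
    apply: le_trans (gap _ _ u Dd Df d0d df) _.
    have : qform f u <= sup Q by apply: ub_le_sup; [case: hQ | exists f].
    have := qform_le u d1d; move: h1; move: (sup Q) => s h1 h2 h3.
    have : B * (qform f u - qform d u) <= B * c by rewrite ler_wpM2l //; lra.
    lra.
  pose P (e : R) (w : H) := exists d, [/\ D d, w = d u &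
    forall f, D f -> op_le d f -> nrm (f u - d u) <= e].
  have [||w hw] := @small_sets_cvg R H P.
  - by move=> e e0; have [d Dd hd] := tail e e0; exists (d u), d.
  - move=> e c _ _ e0 c0 [d [Dd -> hd]] [d' [Dd' -> hd']].
    have [f [Df df d'f]] := dirD _ _ Dd Dd'.
    have := nrm_dist_trans (d u) (f u) (d' u); rewrite (nrmBC (d u) (f u)).
    by move=> h; apply: le_trans h _; apply: lerD; [exact: hd|exact: hd'].
  exists w => e e0; have e2 : 0 < e / 2 by rewrite divr_gt0.
  have [d Dd hd] := tail _ e2; exists d => // f Df df.
  by apply: nrm_dist_half (hd f Df df) _; apply: hw => //; exists d.
have [y hy] := choice cv.
have near (s : seq H) e : 0 < e -> exists2 d, D d &
    forall f, D f -> op_le d f -> forall u, u \in s -> nrm (f u - y u) <= e.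
  move=> e0; elim: s => [|u s [d Dd hd]]; first by exists d0.
  have [d' Dd' hd'] := hy u e e0; have [c [Dc dc d'c]] := dirD _ _ Dd Dd'.
  exists c => // f Df cf v; rewrite inE => /orP[/eqP ->|].
    exact: hd' Df (op_le_trans d'c cf).
  exact: hd Df (op_le_trans dc cf) v.
have approx (s : seq H) e d : 0 < e -> D d -> exists2 f, D f /\ op_le d f &
    forall u, u \in s -> nrm (f u - y u) <= e.
  move=> e0 Dd; have [d' Dd' hd'] := near s e e0.
  by have [c [Dc dc d'c]] := dirD _ _ Dd Dd'; exists c => // u; exact: hd'.
have form u e d : 0 < e -> D d -> exists2 f, D f /\ op_le d f &
    cabs (dotp (f u) u - dotp (y u) u) <= e.
  move=> e0 Dd; have [c c0 ce] := eps_div (nrm_ge0 u) e0.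
  have [f Df /(_ u (mem_head _ _)) fy] := approx [:: u] c d c0 Dd.
  exists f => //; rewrite -dotBl; apply: le_trans (dot_le _ _) _.
  by have := nrm_ge0 u; nra.
exists y; split.
- split=> [a u v|].
    apply/eqP; rewrite -subr_eq0; apply/eqP/nrm_lt_eq0 => e e0.
    have [c c0 ce] := eps_div (addr_ge0 ler01 (cabs_ge0 a)) e0.
    have [f [Df _] hf] := approx [:: a *: u + v; u; v] c d0 c0 Dd0.
    have h1 := hf (a *: u + v) (mem_head _ _).
    have h2 : nrm (f u - y u) <= c by apply: hf; rewrite !inE eqxx orbT.
    have h3 : nrm (f v - y v) <= c by apply: hf; rewrite !inE eqxx !orbT.
    have [lf _] := bD _ Df; move: h1; rewrite lf nrmBC => h1.
    apply: le_trans (nrm_dist_trans _ (a *: f u + f v) _) _.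
    rewrite [X in _ + nrm X](_ : _ = a *: (f u - y u) + (f v - y v)); last first.
      by rewrite scalerBr opprD addrACA.
    have := nrmD (a *: (f u - y u)) (f v - y v); rewrite nrmZ -/(cabs a).
    by have := cabs_ge0 a; nra.
  have [_ [B' B'0 d0B]] := bD _ Dd0.
  exists (B + B') => [|u]; first exact: addr_ge0.
  apply/ler_addgt0Pl => e e0.
  have [f [Df d0f] /(_ u (mem_head _ _)) fy] := approx [:: u] e d0 e0 Dd0.
  have := gap _ _ u Dd0 Df (op_le_refl _) d0f.
  have : qform f u - qform d0 u <= B * nrm u ^+ 2.
    apply: le_trans (qform_bound u B0 zB); rewrite qformB.
    by have := qform_le u (Dz _ Df); lra.
  move=> h1 h2.
  have {h1 h2} h : nrm (f u - d0 u) <= B * nrm u.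
    rewrite -(@ler_pXn2r _ 2) ?nnegrE ?nrm_ge0 ?mulr_ge0 ?nrm_ge0 //.
    apply: le_trans h2 _; rewrite exprMn [B ^+ 2]expr2 -mulrA.
    exact: ler_wpM2l.
  have := nrmD (f u - d0 u) (d0 u); rewrite subrK.
  have := nrmD (y u - f u) (f u); rewrite subrK nrmBC.
  by have := d0B u; lra.
- move=> s e e0; have [f [Df _] hf] := approx s e d0 e0 Dd0.
  by exists f => // u us; rewrite nrmBC; exact: hf.
split=> [d Dd|u e e0].
  apply/op_leP => u; split.
    apply/eqP; rewrite -subr_eq0 -normr_le0.
    apply/ler_addgt0Pl => e e0; have [f [Df df] hf] := form u e d e0 Dd.
    have := le_trans (cabs_Im _) hf; rewrite raddfB /= addr0.
    by have /op_leP/(_ u)[-> _] := df.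
  apply/ler_addgt0Pl => e e0; have [f [Df df] hf] := form u e d e0 Dd.
  have := le_trans (cabs_Re _) hf; rewrite raddfB /= ler_norml => /andP[_].
  by have := qform_le u df; rewrite /qform; lra.
have [f [Df _] hf] := form u e d0 e0 Dd0; exists f => //.
have := le_trans (cabs_Re _) hf; rewrite raddfB /= ler_norml => /andP[+ _].
rewrite /qform; lra.
Qed.

Lemma weak_sup_lub N D x : N x -> D !=set0 -> weak_sup D x -> lub_in op_le N D x.
Proof.
move=> Nx [d0 Dd0] [ub sup]; split=> // y Ny yD; apply/op_leP => u; split.
  have /op_leP/(_ u)[<- _] := ub _ Dd0.
  by have /op_leP/(_ u)[<- _] := yD _ Dd0.
apply/ler_addgt0Pl => e e0; have [d Dd xd] := sup u e e0.
by have := qform_le u (yD _ Dd); lra.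
Qed.

(** In a strongly closed set of operators a least upper bound of a bounded
    directed set is its pointwise limit, hence computed form by form. *)
Lemma lub_weak_sup N D x : N `<=` bounded_op -> strong_closure N `<=` N ->
  D `<=` N `&` selfadjoint -> directed op_le D -> lub_in op_le N D x -> weak_sup D x.
Proof.
move=> Nb Nc DN dirD [Nx xub xlub].
have bN d : N d -> bounded_map d by move=> /Nb/bounded_opP.
have [||y [by_ ny [yub ysup]]] := @vigier D x (bN _ Nx) _ _ dirD xub.
- by move=> d /DN[/bN].
- by move=> d /DN[].
have Ny : N y.
  apply/Nc/strong_closureP; split=> // s e e0.
  by have [d /DN[Nd _] h] := ny s e e0; exists d.
split=> // u e e0; have [d Dd yd] := ysup u e e0; exists d => //.
by have := qform_le u (xlub _ Ny yub); lra.
Qed.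

(** Form convergence at a point is a closed linear condition, so it suffices to
    check it on a total set. *)
Lemma weak_sup_closed D x : bounded_map x -> (forall d, D d -> bounded_map d) ->
  directed op_le D -> (forall d, D d -> op_le d x) ->
  closed_subspace [set u | forall e, 0 < e ->
    exists2 d, D d & qform x u - qform d u <= e].
Proof.
move=> bx bD [[d0 Dd0] dirD] xub.
have pos d : D d -> positive_op (x - d) by exact: xub.
have lin d : D d -> linear (x - d) by move=> /bD bd; have [] := bounded_mapB bx bd.
split=> [e e0|a u v hu hv e e0|u hu e e0].
- by exists d0 => //; rewrite /qform !dot0r /= subrr ltW.
- have a0 : 0 <= 2 * cabs a ^+ 2 + 1 by rewrite addr_ge0 // mulr_ge0 ?sqr_ge0.
  have [c c0 ce] := eps_div a0 e0.
  have [d1 Dd1 h1] := hu _ c0; have [d2 Dd2 h2] := hv _ c0.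
  have [d [Dd d1d d2d]] := dirD _ _ Dd1 Dd2; exists d => //.
  rewrite -qformB; apply: le_trans (qformD_le (lin _ Dd) (pos _ Dd) _ _) _.
  rewrite qformZ ?qformB; last exact: lin.
  have := qform_le u d1d; have := qform_le v d2d => k2 k1.
  have : 2 * (cabs a ^+ 2 * (qform x u - qform d u)) <= 2 * (cabs a ^+ 2 * c).
    by rewrite ler_wpM2l // ler_wpM2l ?sqr_ge0 //; lra.
  lra.
have [_ [B B0 xB]] := bounded_mapB bx (bD _ Dd0).
have e4 : 0 < e / 4 by rewrite divr_gt0.
have [c c0 ce] : exists2 c, 0 < c & B * c ^+ 2 <= e / 4.
  have [c c0 ce] := eps_div B0 e4; exists (Num.min 1 c); first by rewrite lt_min ltr01.
  have : Num.min 1 c ^+ 2 <= c.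
    rewrite expr2; have m0 : 0 <= Num.min 1 c by rewrite le_min ler01 ltW.
    have m1 : Num.min 1 c <= 1 by rewrite ge_min lexx.
    have m2 : Num.min 1 c <= c by rewrite ge_min lexx orbT.
    by move: (Num.min 1 c) m0 m1 m2 => m *; nra.
  by move=> h; have := ler_wpM2l B0 h; lra.
have [v hv uv] := hu _ c0; have [d1 Dd1 h1] := hv _ e4.
have [d [Dd d0d d1d]] := dirD _ _ Dd0 Dd1; exists d => //.
rewrite -qformB -[u](subrK v).
apply: le_trans (qformD_le (lin _ Dd) (pos _ Dd) _ _) _.
have h2 : qform (x - d) (u - v) <= e / 4.
  apply: le_trans ce; apply: le_trans (_ : B * nrm (u - v) ^+ 2 <= _).
    apply: le_trans (qform_bound (u - v) B0 xB); rewrite !qformB.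
    by have := qform_le (u - v) d0d; lra.
  by rewrite ler_wpM2l // ler_pXn2r ?nnegrE ?nrm_ge0 ?(ltW c0).
have := qform_le v d1d; rewrite (qformB x d v); lra.
Qed.

End DirectedSuprema.

(** * Decomposition of the kernel of a completely positive map *)

(** Cauchy-Schwarz inequality between a finite family and a single vector, for
    a positive kernel that is sesquilinear in a vector variable. *)
Lemma kernel_cauchy (R : realType) (Y : Type) (V : lmodType R[i])
    (k : Y * V -> Y * V -> R[i]) :
  (forall l, 0 <= \sum_(p <- l) \sum_(q <- l) k p q) ->
  (forall z p q, k (p.1, z *: p.2) q = z * k p q) ->
  (forall z p q, k p (q.1, z *: q.2) = Num.conj z * k p q) ->
  forall l p, cabs (\sum_(q <- l) k q p) ^+ 2 <=
    complex.Re (\sum_(q <- l) \sum_(q' <- l) k q q') * complex.Re (k p p).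
Proof.
move=> k_pos kZl kZr l p.
have pp0 : 0 <= k p p by have := k_pos [:: p]; rewrite !big_seq1.
have [] := @psd_cross R (\sum_(q <- l) \sum_(q' <- l) k q q') (k p p)
  (\sum_(q <- l) k q p) (\sum_(q <- l) k p q) pp0; last by [].
move=> z; have := k_pos ((p.1, z *: p.2) :: l); rewrite !big_cons kZl kZr.
have -> : \sum_(q <- l) k (p.1, z *: p.2) q = z * \sum_(q <- l) k p q.
  by rewrite mulr_sumr; apply: eq_bigr => q _; rewrite kZl.
have -> : \sum_(q <- l) \sum_(q' <- (p.1, z *: p.2) :: l) k q q' =
    Num.conj z * (\sum_(q <- l) k q p) + \sum_(q <- l) \sum_(q' <- l) k q q'.
  rewrite mulr_sumr -big_split; apply: eq_bigr => q _ /=.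
  by rewrite big_cons kZr.
by congr (_ <= _); ring.
Qed.

Section Kolmogorov.
Context {R : realType} {G H : hilbertType R}.
Local Notation C := R[i].
Variables (A : set (G -> G)) (B : set (H -> H)) (S : (G -> G) -> H -> H).
Hypotheses (vA : von_neumann_algebra A) (vB : von_neumann_algebra B).
Hypothesis ucpS : normal_ucp A B S.

Local Notation Aelt := {a : G -> G | A a}.
Local Notation E := (Aelt * H)%type.
Implicit Types (p q : E) (l m : seq E) (a b : Aelt) (h g : H).

Let adj_ex a : exists c : Aelt, is_adjoint (sval a) (sval c).
Proof. by have [c Ac ac] := vna_adjoint_ex vA (svalP a); exists (exist _ c Ac). Qed.

Let adj a : Aelt := sval (cid (adj_ex a)).
Let adjP a : is_adjoint (sval a) (sval (adj a)).
Proof. exact: svalP (cid (adj_ex a)). Qed.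

Let one : Aelt := exist _ idfun (vna_id vA).

Let SB a : B (S (sval a)).
Proof. by case: ucpS => SB _ _ _ _; exact: SB (svalP a). Qed.

Let star_mul a b : Aelt := exist _ _ (vna_comp vA (svalP (adj a)) (svalP b)).

Let Sbd a b : bounded_map (S (sval (star_mul a b))).
Proof. exact/(vna_bounded_map vB)/SB. Qed.

Let kap p q : C := dotp (S (sval (star_mul q.1 p.1)) p.2) q.2.

Let kap_pos l : 0 <= \sum_(p <- l) \sum_(q <- l) kap p q.
Proof.
case: ucpS => _ _ cp _ _.
pose t := tnth (in_tuple l).
have pos : positive_mx (fun i j => sval (star_mul (t i).1 (t j).1)).
  move=> u; pose w := \sum_(i < size l) sval (t i).1 (u i).
  rewrite [X in 0 <= X](_ : _ = dotp w w) ?dot_ge0 //.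
  rewrite [RHS]dot_sumr; apply: eq_bigr => i _; rewrite dot_suml.
  by apply: eq_bigr => j _; exact: (is_adjoint_sym (adjP _)).
have := cp _ _ (fun i j => svalP (star_mul (t i).1 (t j).1)) pos (fun i => (t i).2).
rewrite exchange_big (big_tnth _ _ l).
by under [X in _ -> _ <= X]eq_bigr do rewrite big_tnth.
Qed.

Let kapZl z p q : kap (p.1, z *: p.2) q = z * kap p q.
Proof. by rewrite /kap /= (linZ (proj1 (Sbd _ _))) dotZl. Qed.

Let kapZr z p q : kap p (q.1, z *: q.2) = Num.conj z * kap p q.
Proof. by rewrite /kap /= dotZr. Qed.

(** Functionals are indexed together with a natural number so that the same
    functional may be used any number of times. *)
Local Notation X := (((G -> G) -> (H -> H)) * nat)%type.

Let ev (x : X) l : H := \sum_(p <- l) x.1 (sval p.1) p.2.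

Let gram l : R := complex.Re (\sum_(p <- l) \sum_(q <- l) kap p q).

(** The families of functionals [phi] on [A] with values in [B] for which
    [sum_phi |sum_k phi(a_k) h_k|^2] is at most the squared length
    [sum <S (a_l^* a_k) h_k, h_l>] of the formal vector [sum_k a_k (x) h_k] in
    the Stinespring space of [S]. A maximal family attains equality, and so
    embeds that space isometrically into [H]-valued families. *)
Definition dominated (F : set X) :=
  (forall x a, F x -> B (x.1 (sval a))) /\
  forall (e : {fset X}), (forall x, x \in e -> F x) -> forall l,
    \sum_(x <- e) nrm (ev x l) ^+ 2 <= gram l.

Section Residual.
Variable F : set X.
Hypothesis dF : dominated F.

Let comp p (x : X) : H := if `[< F x >] then x.1 (sval p.1) p.2 else 0.

Let restrict_dominated l (e : {fset X}) :
  \sum_(x <- e) nrm (if `[< F x >] then ev x l else 0) ^+ 2 <= gram l.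
Proof.
rewrite (big_fsetID _ (fun x => `[< F x >])) /= [X in _ + X]big1_fset ?addr0; last first.
  by move=> x; rewrite !inE /= => /andP[_ /negbTE ->] _; rewrite nrm0 expr0n.
case: dF => _ /(_ [fset x in e | `[< F x >]]%fset _ l) h.
apply: le_trans (h _) => [|x]; last by rewrite !inE /= => /andP[_ /asboolP].
rewrite big_seq [leRHS]big_seq; apply: ler_sum => x.
by rewrite !inE /= => /andP[_ ->].
Qed.

Let comp_summable p : comp p \in @square_summable R X H.
Proof.
apply/square_summableP; exists (gram [:: p]) => e.
apply: le_trans (restrict_dominated [:: p] e); apply: ler_sum => x _.
by rewrite /comp /ev big_seq1.
Qed.

Let v p : l2 X H := L2 (comp_summable p).

Let vE p x : v p x = if `[< F x >] then x.1 (sval p.1) p.2 else 0.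
Proof. by []. Qed.

Let V l : l2 X H := \sum_(p <- l) v p.

Let VE l x : V l x = if `[< F x >] then ev x l else 0.
Proof.
rewrite /V l2_sum /ev; case: ifP => Fx.
  by apply: eq_bigr => p _; rewrite vE Fx.
by rewrite big1 // => p _; rewrite vE Fx.
Qed.

Let v_lin z a h g : v (a, z *: h + g) = z *: v (a, h) + v (a, g).
Proof.
apply: l2_ext => x; rewrite l2_add l2_scale !vE; case: asboolP => [Fx|_].
  by case: dF => /(_ x a Fx) /(vna_bounded_map vB)[-> _].
by rewrite scaler0 addr0.
Qed.

Let nrm_V l : nrm (V l) ^+ 2 <= gram l.
Proof.
have g0 : 0 <= gram l by have := restrict_dominated l fset0; rewrite big_seq_fset0.
rewrite -(sqr_sqrtr g0) ler_pXn2r ?nnegrE ?nrm_ge0 ?sqrtr_ge0 //.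
apply: l2nrm_le_sum => [|e]; first exact: sqrtr_ge0.
rewrite sqr_sqrtr //; apply: le_trans (restrict_dominated l e).
by apply: ler_sum => x _; rewrite VE.
Qed.

Let rho p q : C := kap p q - dotp (v p) (v q).

Let rho_sum l m : \sum_(p <- l) \sum_(q <- m) rho p q =
  \sum_(p <- l) \sum_(q <- m) kap p q - dotp (V l) (V m).
Proof.
rewrite /V dot_suml -sumrB; apply: eq_bigr => p _.
by rewrite dot_sumr -sumrB.
Qed.

Let rho_pos l : 0 <= \sum_(p <- l) \sum_(q <- l) rho p q.
Proof.
rewrite rho_sum subr_ge0 dot_nrm.
have /complex_realP[r kr] : \sum_(p <- l) \sum_(q <- l) kap p q \is Num.real.
  exact/ger0_real/kap_pos.
by have := nrm_V l; rewrite /gram kr lecR.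
Qed.

Let vZ z p : v (p.1, z *: p.2) = z *: v p.
Proof.
by case: p => a h; apply: (linZ (f := fun h => v (a, h))) => k g1 g2; exact: v_lin.
Qed.

Let rhoZl z p q : rho (p.1, z *: p.2) q = z * rho p q.
Proof. by rewrite /rho kapZl vZ dotZl mulrBr. Qed.

Let rhoZr z p q : rho p (q.1, z *: q.2) = Num.conj z * rho p q.
Proof. by rewrite /rho kapZr vZ dotZr mulrBr. Qed.

Let rho_cauchy l p :
  cabs (\sum_(q <- l) rho q p) ^+ 2 <=
  complex.Re (\sum_(q <- l) \sum_(q' <- l) rho q q') * complex.Re (rho p p).
Proof. exact: kernel_cauchy rho_pos rhoZl rhoZr l p. Qed.

Let kap_bound a : exists2 M, 0 <= M &
  forall h, complex.Re (kap (a, h) (a, h)) <= M * nrm h ^+ 2.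
Proof.
have [_ [M M0 SM]] := Sbd a a; exists M => // h.
exact: (qform_bound h M0 SM).
Qed.

Let v_bounded a : bounded_map (fun h => v (a, h)).
Proof.
have [M M0 aM] := kap_bound a; split=> [z h g|]; first exact: v_lin.
exists (1 + M) => [|h]; first by rewrite addr_ge0.
rewrite -(@ler_pXn2r _ 2) ?nnegrE ?nrm_ge0 ?mulr_ge0 ?nrm_ge0 ?addr_ge0 //.
have := nrm_V [:: (a, h)]; rewrite /V /gram !big_seq1 => /le_trans; apply.
apply: le_trans (aM h) _; rewrite exprMn ler_wpM2r ?sqr_ge0 //.
by rewrite expr2; nra.
Qed.

Let res_ex a b : exists2 r : H -> H, bounded_map r &
  forall h g, dotp (r h) g = rho (b, h) (a, g).
Proof.
have [w bw wP] := adjoint_ex (v_bounded a).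
exists (S (sval (star_mul a b)) - (w \o fun h => v (b, h))).
  by apply: bounded_mapB; [exact: Sbd | exact: bounded_map_comp (v_bounded b)].
move=> h g; rewrite fun_addE fun_oppE dotBl /rho /=; congr (_ - _).
by rewrite dotC -wP -dotC.
Qed.

(** An operator commuting with [B] commutes with every entry of the residual
    kernel, so the entries lie in [B] by the bicommutant theorem. *)
Let res_B a b (r : H -> H) : bounded_map r ->
  (forall h g, dotp (r h) g = rho (b, h) (a, g)) -> B r.
Proof.
move=> br rP; apply: (bicommutant vB br) => y yc u; case: (yc) => by_ ycB.
have [z bz yz] := adjoint_ex by_; have [_ zcB] := commutant_adjoint vB yc bz yz.
apply: dot_inj => w; rewrite dotC [RHS]dotC; congr (Num.conj _).
rewrite yz !rP /rho /kap /= -ycB; last exact: (SB (star_mul a b)).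
rewrite yz; congr (_ - _); apply: l2_dotE.
rewrite (_ : (fun x => _) = fun x => dotp (v (b, u) x) (v (a, z w) x)).
  exact: l2_dotp.
apply/funext => x; rewrite !vE; case: asboolP => [Fx|_]; last by rewrite !dot0l.
case: dF => FB _.
by rewrite -(ycB _ (FB x b Fx)) yz zcB //; exact: FB.
Qed.

(** The row [r] of the residual kernel at [a] is a functional with values in
    [B]. With [g = sum_k r a_k h_k], the inequality of Cauchy and Schwarz bounds
    [|g|^4] by the residual length times [M |g|^2], so that [r / (1 + M)] fits
    into the gap left by the family. *)
Let residual_functional a : exists phi : (G -> G) -> (H -> H),
  [/\ forall b, B (phi (sval b)),
      forall n l, nrm (ev (phi, n) l) ^+ 2 <= gram l - nrm (V l) ^+ 2 &
      forall b h, phi (sval b) h = 0 -> forall g, rho (b, h) (a, g) = 0].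
Proof.
have [M M0 aM] := kap_bound a.
have rex b : exists r : H -> H, bounded_map r /\
    forall h g, dotp (r h) g = rho (b, h) (a, g).
  by have [r br rP] := res_ex a b; exists r.
have [r rP] := choice rex.
pose c : R := (1 + M)^-1.
have M1 : 0 < 1 + M by rewrite ltr_wpDr.
have c0 : 0 < c by rewrite invr_gt0.
pose phi (f : G -> G) : H -> H :=
  if pselect (A f) is left Af then c%:C *: r (exist _ f Af) else 0.
have phiE b : phi (sval b) = c%:C *: r b.
  case: b => f Af /=; rewrite /phi; case: pselect => // Af'.
  by rewrite (Prop_irrelevance Af Af').
exists phi; split=> [b|n l|b h].
- rewrite phiE -[_ *: _]addr0; have [br rB] := rP b.
  exact: (vna_linear vB) (res_B br rB) (vna_zero vB).
- have evE : ev (phi, n) l = c%:C *: \sum_(p <- l) r p.1 p.2.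
    by rewrite /ev /= scaler_sumr; apply: eq_bigr => p _; rewrite phiE.
  rewrite evE; set g := \sum_(p <- l) r p.1 p.2.
  have gE : dotp g g = \sum_(p <- l) rho p (a, g).
    rewrite dot_suml; apply: eq_bigr => p _; rewrite (rP _).2.
    by rewrite -surjective_pairing.
  have := rho_cauchy l (a, g); rewrite -gE dot_nrm cabsR ger0_norm ?sqr_ge0 //.
  have -> : complex.Re (\sum_(q <- l) \sum_(q' <- l) rho q q') =
      gram l - nrm (V l) ^+ 2 by rewrite rho_sum raddfB /= -nrm_sqr.
  have l0 : 0 <= gram l - nrm (V l) ^+ 2 by rewrite subr_ge0 nrm_V.
  move: (gram l - _) l0 => t t0.
  have rM : complex.Re (rho (a, g) (a, g)) <= M * nrm g ^+ 2.
    rewrite /rho raddfB /= -nrm_sqr; have := aM g.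
    by have := sqr_ge0 (nrm (v (a, g))); lra.
  move=> h; have {}h := le_trans h (ler_wpM2l t0 rM).
  have {h} gt : nrm g ^+ 2 <= M * t.
    have [->|g0] := eqVneq (nrm g) 0; first by rewrite expr0n mulr_ge0.
    have gp : 0 < nrm g ^+ 2 by rewrite exprn_gt0 // lt_neqAle eq_sym g0 nrm_ge0.
    by move: h; rewrite mulrA expr2 ler_pM2r // mulrC.
  rewrite nrmZ -/(cabs _) cabsR gtr0_norm // exprMn.
  apply: le_trans (ler_wpM2l (sqr_ge0 c) gt) _.
  have : c ^+ 2 * M <= 1.
    by rewrite exprVn mulrC ler_pdivrMr ?exprn_gt0 // mul1r expr2; nra.
  by rewrite mulrA => h; have := ler_wpM2r t0 h; rewrite mul1r.
rewrite phiE => /eqP; rewrite fun_scaleE scaler_eq0 => /orP[/eqP[cz]|/eqP rh] g.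
  by rewrite cz ltxx in c0.
by rewrite -(rP b).2 rh dot0l.
Qed.

(** At a maximal dominated family the residual kernel vanishes: otherwise it
    supplies a new functional, which maximality would force to occur infinitely
    often in the family. *)
Let maximal_rho0 : (forall y, dominated (F `|` [set y]) -> F y) ->
  forall p q, rho p q = 0.
Proof.
move=> Fmax [b h] [a g]; have [phi [phiB phiV]] := residual_functional a; apply.
have Fphi n : F (phi, n).
  apply: Fmax; split=> [x b' [Fx|->]|e eF l].
  - by case: dF => FB _; exact: FB.
  - exact: phiB.
  have := phiV n l; set y := (phi, n).
  have Vle : \sum_(x <- (e `\ y)%fset) nrm (ev x l) ^+ 2 <= nrm (V l) ^+ 2.
    apply: le_trans (l2nrm_ge_sum (V l) (e `\ y)%fset).
    rewrite big_seq [leRHS]big_seq; apply: ler_sum => x.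
    rewrite VE !inE => /andP[/eqP xy xe].
    by have [Fx|//] := eF _ xe; rewrite asboolT.
  have [ye|ye] := boolP (y \in e).
    by rewrite (big_fsetD1 _ ye) /=; lra.
  have -> : e = (e `\ y)%fset by apply/esym/mem_fsetD1.
  by have := sqr_ge0 (nrm (ev y l)); lra.
apply/nrm0_eq0/eqP; rewrite -sqrf_eq0 eq_le sqr_ge0 andbT.
apply/ler_addgt0Pl => e e0; rewrite addr0.
set s := nrm _ ^+ 2; have s0 : 0 <= s by exact: sqr_ge0.
(* [n] copies of [phi] inside the family force [n * s <= t] for every [n]. *)
pose t := gram [:: (b, h)].
pose n := (Num.truncn (t / e)).+1.
pose f := [fset (phi, val i) | i in 'I_n]%fset.
case: dF => _ /(_ f _ [:: (b, h)]) ft.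
have {}ft : n%:R * s <= t.
  apply: le_trans (ft _) => [|x /imfsetP[i _ ->]]; last exact: Fphi.
  rewrite big_imfset /=; last by move=> i j _ _ [] /val_inj.
  rewrite (eq_bigr (fun=> s)) => [|i _]; last by rewrite /ev big_seq1.
  rewrite big_const_seq count_predT iter_addr addr0 /=.
  by rewrite size_enum_ord mulr_natl.
have n0 : 0 < n%:R :> R by rewrite ltr0n.
have tn : t / e < n%:R by rewrite truncnS_gt.
rewrite -(ler_pM2l n0); apply: le_trans ft _.
by move: tn; rewrite ltr_pdivrMr // => /ltW.
Qed.

Lemma maximal_dominated_gram : (forall y, dominated (F `|` [set y]) -> F y) ->
  exists w : (G -> G) -> H -> l2 X H,
    (forall (a : G -> G) h x, A a -> w a h x = if `[< F x >] then x.1 a h else 0) /\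
    forall (a b c : G -> G) h g, A a -> A b -> A c -> is_adjoint b c ->
      dotp (w a h) (w b g) = dotp (S (c \o a) h) g.
Proof.
move=> Fmax.
pose w (a : G -> G) h : l2 X H :=
  if pselect (A a) is left Aa then v (exist _ a Aa, h) else 0.
have wE (a : G -> G) h (Aa : A a) : w a h = v (exist _ a Aa, h).
  by rewrite /w; case: pselect => // Aa'; rewrite (Prop_irrelevance Aa Aa').
exists w; split=> [a h x Aa|a b c h g Aa Ab Ac bc]; first by rewrite (wE _ _ Aa) vE.
rewrite (wE _ _ Aa) (wE _ _ Ab).
have /eqP := maximal_rho0 Fmax (exist _ a Aa, h) (exist _ b Ab, g).
rewrite /rho subr_eq0 => /eqP <-; rewrite /kap /=.
congr (dotp (S (_ \o _) _) _); apply/funext => u; apply: dot_inj => t.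
by rewrite -(adjP (exist _ b Ab)) -bc.
Qed.

End Residual.

Let start : X := (S, 0%N).

(** Kadison's inequality, obtained from Cauchy-Schwarz for the kernel against
    the vector [sum_k S a_k h_k] at the unit of [A]. *)
Let start_dominated : dominated [set start].
Proof.
split=> [x a ->|e eS l]; first exact: SB.
have {eS} eS : (e `<=` [fset start])%fset.
  by apply/fsubsetP => x /eS /= ->; rewrite inE.
apply: le_trans (ler_sum_fset _ eS) _ => [x|]; first exact: sqr_ge0.
rewrite big_seq_fset1; set g := ev start l.
have kone p h : kap p (one, h) = dotp (S (sval p.1) p.2) h.
  rewrite /kap /=; congr (dotp (S _ _) _); apply/funext => u.
  by apply: dot_inj => t; rewrite -(adjP one).
have := kernel_cauchy kap_pos kapZl kapZr l (one, g); rewrite -/(gram l).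
have -> : \sum_(q <- l) kap q (one, g) = dotp g g.
  by rewrite {1}/g /ev dot_suml; apply: eq_bigr => q _; exact: kone.
have -> : kap (one, g) (one, g) = dotp g g.
  by rewrite kone; case: ucpS => _ _ _ /= ->.
rewrite dot_nrm cabsR ger0_norm ?sqr_ge0 //=.
have [->|g0] := eqVneq (nrm g) 0.
  by rewrite expr0n /= => _; have := kap_pos l; rewrite lecE => /andP[].
have gp : 0 < nrm g ^+ 2 by rewrite exprn_gt0 // lt_neqAle eq_sym g0 nrm_ge0.
by rewrite expr2 ler_pM2r.
Qed.

(** Domination only involves finitely many functionals at a time, so it passes
    to unions of chains. *)
Lemma maximal_dominated : exists F, [/\ F start, dominated F &
  forall y, dominated (F `|` [set y]) -> F y].
Proof.
pose P F := dominated (F `|` [set start]).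
have [Ch ChP tot|F [PF maxF]] := @Zorn_bigcup X P.
  have fin (s : seq X) : (forall x, x \in s -> (\bigcup_(Z in Ch) Z `|` [set start]) x) ->
      exists2 Z, P Z & forall x, x \in s -> (Z `|` [set start]) x.
    move=> hs; suff [Z [ZC|Z0] hZ] : exists2 Z, Ch Z \/ Z = set0 &
        forall x, x \in s -> (Z `|` [set start]) x.
    - by exists Z => //; exact: ChP.
    - by exists Z => //; rewrite Z0 /P set0U; exact: start_dominated.
    elim: s hs => [|x s IH] hs; first by exists set0; [right|].
    have [|Z ZC hZ] := IH; first by move=> y ys; apply: hs; rewrite inE ys orbT.
    have [[Y CY Yx]|xs] := hs x (mem_head _ _); last first.
      by exists Z => // y; rewrite inE => /orP[/eqP ->|/hZ //]; right.
    have [ZY|YZ] : Z `<=` Y \/ Y `<=` Z.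
    - case: ZC => [ZC|->]; last by left.
      exact: tot.
    - exists Y; first by left.
      move=> y; rewrite inE => /orP[/eqP ->|/hZ[/ZY|]]; by [left|right].
    - exists Z => // y; rewrite inE => /orP[/eqP ->|/hZ //]; left; exact: YZ.
  split=> [x a Fx|e eF l].
    have [|Z [ZB _] hZ] := fin [:: x]; first by move=> y; rewrite inE => /eqP ->.
    by apply: ZB; apply: hZ; rewrite inE.
  by have [Z [_ Zd] hZ] := fin e eF; exact: Zd.
exists (F `|` [set start]); split=> // [|y]; first by right.
rewrite -setUA [X in _ `|` X]setUC setUA => Py.
have [Fy|nFy] := pselect (F y); first by left.
exfalso; apply: (maxF (F `|` [set y])) => //; split=> [|h].
  exact: subsetUl.
by apply: nFy; apply: h; right.
Qed.

End Kolmogorov.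

(** Kolmogorov decomposition of [S] with values in [B]: a representation of the
    kernel [S (b^* a)] by square-summable families of elements of [B], one of
    whose components is [S] itself. *)
Lemma kolmogorov_decomposition (R : realType) (G H : hilbertType R)
    (A : set (G -> G)) (B : set (H -> H)) (S : (G -> G) -> H -> H) :
  von_neumann_algebra A -> von_neumann_algebra B -> normal_ucp A B S ->
  exists (I : choiceType) (i0 : I) (w : (G -> G) -> H -> l2 I H),
    [/\ forall a i, A a -> B (fun h => w a h i),
        forall a h, A a -> w a h i0 = S a h &
        forall a b c h g, A a -> A b -> A c -> is_adjoint b c ->
          dotp (w a h) (w b g) = dotp (S (c \o a) h) g].
Proof.
move=> vA vB ucpS; have [F [F0 dF Fmax]] := maximal_dominated vA vB ucpS.
have [w [wE wG]] := maximal_dominated_gram vB ucpS dF Fmax.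
exists (((G -> G) -> (H -> H)) * nat)%type, (S, 0%N), w; split=> // [a i Aa|a h Aa].
  have [Fi|nFi] := pselect (F i).
    rewrite (_ : (fun h => _) = i.1 a); first exact: (dF.1 i (exist _ a Aa)).
    by apply/funext => h; rewrite wE // asboolT.
  rewrite (_ : (fun h => _) = 0); first exact: vna_zero vB.
  by apply/funext => h; rewrite wE // asboolF.
by rewrite wE // asboolT.
Qed.

(** * Matrix entries and slices *)

Section OperatorEntries.
Context {R : realType}.
Local Notation C := R[i].

Lemma ge0_approx (a : C) :
  (forall e, 0 < e -> exists2 z : C, 0 <= z & cabs (a - z) <= e) -> 0 <= a.
Proof.
move=> ha; rewrite lecE /=; apply/andP; split.
  rewrite -normr_le0; apply/ler_addgt0Pl => e e0; rewrite addr0.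
  have [z z0 az] := ha e e0; apply: le_trans az.
  by have := cabs_Im (a - z); rewrite raddfB /= (ger0_Im z0) subr0.
rewrite -oppr_le0; apply/ler_addgt0Pl => e e0; rewrite addr0.
have [z z0 az] := ha e e0; have := le_trans (cabs_Re _) az.
rewrite raddfB /= ler_norml; move: z0; rewrite lecE => /andP[_ /= z0].
by move=> /andP[]; lra.
Qed.

Lemma fun_sumE (T : Type) (W : zmodType) (J : Type) (s : seq J) (F : J -> T -> W) u :
  (\sum_(j <- s) F j) u = \sum_(j <- s) F j u.
Proof. by elim: s => [|j s IH]; rewrite ?big_nil // !big_cons fun_addE IH. Qed.

Variables (I : choiceType) (H : hilbertType R).
Local Notation T := (l2_tensor I H).
Local Notation K := (l2 I (cline R)).

Definition entry (x : l2 I H -> l2 I H) (i j : I) : H -> H :=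
  fun h => x (single j h) i.

Lemma entry_bounded x i j : bounded_map x -> bounded_map (entry x i j).
Proof.
move=> bx; exact: bounded_map_comp (coord_bounded H i)
  (bounded_map_comp bx (single_bounded H j)).
Qed.

Lemma trunc_all (s : seq (l2 I H)) e : 0 < e -> exists E : {fset I},
  forall u, u \in s -> nrm (u - trunc E u) <= e.
Proof.
move=> e0; suff [E hE] : exists E0 : {fset I}, forall E : {fset I}, (E0 `<=` E)%fset ->
    forall u, u \in s -> nrm (u - trunc E u) <= e.
  by exists E; exact: hE (fsubset_refl E).
elim: s => [|u s [E hE]]; first by exists fset0.
have [E' hE'] := trunc_cvg u e0; exists (E `|` E')%fset => E2 sE v.
rewrite inE => /orP[/eqP ->|vs].
  exact: hE' (fsubset_trans (fsubsetUr _ _) sE).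
exact: hE (fsubset_trans (fsubsetUl _ _) sE) v vs.
Qed.

(** An operator whose matrix entries lie in [B] is the pointwise limit of its
    finite corners, which are finite sums of elementary tensors. *)
Lemma entries_vn_tensor (B : set (H -> H)) (x : T -> T) :
  bounded_map x -> (forall i j, B (entry x i j)) ->
  vn_tensor (T := T) B bounded_op x.
Proof.
move=> bx xB; apply/strong_closureP; split=> // s e e0.
case: (bx) => lx [M M0 xM].
have e2 : 0 < e / 2 by rewrite divr_gt0.
have [d d0 de] := eps_div M0 e2.
have m0 : 0 < Num.min d (e / 2) by rewrite lt_min d0.
have [E hE] := trunc_all (s ++ [seq x u | u <- s]) m0.
have {hE} hE u : u \in s -> nrm (u - trunc E u) <= d /\ nrm (x u - trunc E (x u)) <= e / 2.
  move=> us; have := hE u; have := hE (x u).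
  rewrite !mem_cat us (map_f x us) orbT !le_min => /(_ isT)/andP[_ ->].
  by move=> /(_ isT)/andP[-> _].
exists (fun u => trunc E (x (trunc E u))).
  pose c (p : I * I) : T -> T := fun u => single p.1 (entry x p.1 p.2 (u p.2)).
  rewrite (_ : (fun u => _) = \sum_(p <- [seq (i, j) | i <- E, j <- E]) c p).
    apply: lin_span_sum => [[i j]].
    exists (entry x i j), ((single i : cline R -> K) \o (fun k : K => k j)); split=> //.
      apply/bounded_opP; apply: bounded_map_comp (single_bounded _ i) _.
      exact: coord_bounded.
    split=> [|u k].
      apply/bounded_opP; apply: bounded_map_comp (single_bounded _ i) _.
      exact: bounded_map_comp (entry_bounded i j bx) (coord_bounded H j).
    rewrite /c /=; apply: l2_ext => m; rewrite singleE l2tensorE /=.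
    case: eqP => _; last by rewrite scale0r.
    by rewrite (linZ (proj1 (entry_bounded i j bx))).
  apply/funext => u; rewrite fun_sumE big_allpairs /= /trunc.
  apply: eq_bigr => i _; rewrite (lin_sum lx) l2_sum (lin_sum (single_linear i)).
  by apply: eq_bigr.
move=> u /hE[h1 h2].
apply: nrm_dist_half h2 _.
have lt : linear (trunc E : l2 I H -> l2 I H).
  move=> a f g; apply: l2_ext => i; rewrite l2_add l2_scale !truncE l2_add l2_scale.
  by case: ifP => // _; rewrite scaler0 addr0.
rewrite -(linB lt); apply: le_trans (nrm_trunc _ _) _; rewrite -(linB lx).
by apply: le_trans (xM _) _; nra.
Qed.

End OperatorEntries.

Section Slice.
Context {R : realType} {I : choiceType} {H : hilbertType R}.
Local Notation C := R[i].
Local Notation T := (l2_tensor I H).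
Local Notation K := (l2 I (cline R)).
Variables (B : set (H -> H)) (i0 : I).
Hypothesis vB : von_neumann_algebra B.
Local Notation N := (vn_tensor (T := T) B bounded_op).
Local Notation k0 := (unit_vec i0 : K).
Local Notation psi := (vector_state k0).

Lemma vn_tensor_bounded : N `<=` bounded_op.
Proof. by move=> x []. Qed.

Lemma vn_tensor_closed : strong_closure N `<=` N.
Proof.
move=> x /strong_closureP[bx nx]; apply/strong_closureP; split=> //.
exact: strongly_near_trans.
Qed.

Lemma nrm_unit_vec : `|k0| = 1.
Proof.
have n1 : nrm (1 : cline R) = 1.
  by rewrite -[LHS]/(cabs (1%:C)) cabsR normr1.
by rewrite nrmE nrm_single n1.
Qed.

Lemma vector_state_normal (W : hilbertType R) (k : W) : `|k| = 1 ->
  normal_state bounded_op (vector_state k).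
Proof.
move=> k1; split=> [a x y _ _|x _ px| |D x DN dirD xlub].
- by rewrite /vector_state fun_addE fun_scaleE dotDl dotZl.
- exact: px.
- by rewrite /vector_state /= -dotp_norm k1 expr1n.
have [xub xsup] : weak_sup D x.
  apply: lub_weak_sup DN dirD xlub => [//|y []]; exact.
split=> // [_ [d Dd <-]|y _ yD].
  by have := xub _ Dd k; rewrite fun_addE fun_oppE dotBl subr_ge0.
case: dirD => [[d0 Dd0] _].
have := yD _ (ex_intro2 _ _ d0 Dd0 erefl); rewrite /vector_state !lecE => /andP[/eqP -> _].
have /op_leP/(_ k)[-> _] := xub _ Dd0; rewrite eqxx /=.
apply/ler_addgt0Pl => e e0; have [d Dd xd] := xsup k e e0.
have := yD _ (ex_intro2 _ _ d Dd erefl); rewrite /vector_state lecE => /andP[_].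
by move: xd; rewrite /qform; lra.
Qed.

Lemma slice_tensor b c x : is_tensor_op (T := T) b c x ->
  entry x i0 i0 = psi c *: b.
Proof.
move=> [_ xt]; apply/funext => h; rewrite /entry -(l2tensor_unit h i0).
rewrite -[l2tensor h _]/(tensor T h k0) xt /=.
by rewrite fun_scaleE /vector_state dot_single_r cline_dotE conjC1 mulr1.
Qed.

Lemma qform_entry (x : T -> T) h : qform (entry x i0 i0) h = qform x (single i0 h).
Proof. by rewrite /qform dot_single_r. Qed.

Lemma slice_range x : N x -> B (entry x i0 i0).
Proof.
move=> /strong_closureP[bx nx]; apply: (vna_strong vB); first exact: entry_bounded.
move=> s e e0; have [y [n [a [f [fT ->]]]] xy] := nx [seq single i0 h | h <- s] e e0.
exists (entry (\sum_(i < n) a i *: f i) i0 i0); last first.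
  move=> h hs; rewrite /entry -l2_opp -l2_add.
  by apply: le_trans (nrm_coord _ _) _; apply: xy; exact: map_f.
rewrite (_ : entry _ _ _ = \sum_(i < n) a i *: entry (f i) i0 i0).
  elim/big_ind : _ => [|f1 f2 B1 B2|i _]; first exact: vna_zero vB.
    by rewrite -[f1]scale1r; exact: (vna_linear vB).
  have [b [c [Bb _ /slice_tensor ->]]] := fT i.
  rewrite scalerA -[_ *: b]addr0; exact: (vna_linear vB) Bb (vna_zero vB).
by apply/funext => h; rewrite /entry !fun_sumE l2_sum.
Qed.

(** The slice by the vector state at [unit_vec i0] is compression to a diagonal
    entry, and compressions commute with pointwise limits. *)
Lemma slice_expectation :
  tensor_expectation (T := T) B bounded_op psi (fun x => entry x i0 i0).
Proof.
split=> [x|a x y _ _|x _ px h|D x DN dirD xlub|b c x _ _].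
- exact: slice_range.
- by apply/funext.
- by rewrite /entry -dot_single_r.
- have [xub xsup] := lub_weak_sup vn_tensor_bounded vn_tensor_closed DN dirD xlub.
  apply: weak_sup_lub; first by case: xlub => Nx _ _; exact: slice_range.
    by case: dirD => [[d Dd] _]; exists (entry d i0 i0), d.
  split=> [_ [d Dd <-]|h e e0].
    move=> h; have := xub _ Dd (single i0 h).
    by rewrite fun_addE fun_oppE dot_single_r.
  have [d Dd xd] := xsup (single i0 h) e e0; exists (entry d i0 i0); first by exists d.
  by rewrite !qform_entry.
- exact: slice_tensor.
Qed.

End Slice.

(** * The dilation *)

Section Dilation.
Context {R : realType} {G H : hilbertType R}.
Local Notation C := R[i].
Variables (A : set (G -> G)) (B : set (H -> H)) (S : (G -> G) -> H -> H).
Hypotheses (vA : von_neumann_algebra A) (vB : von_neumann_algebra B).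
Hypothesis ucpS : normal_ucp A B S.
Variables (I : choiceType) (i0 : I) (w : (G -> G) -> H -> l2 I H).
Hypothesis wB : forall a i, A a -> B (fun h => w a h i).
Hypothesis w0 : forall a h, A a -> w a h i0 = S a h.
Hypothesis wG : forall a b c h g, A a -> A b -> A c -> is_adjoint b c ->
  dotp (w a h) (w b g) = dotp (S (c \o a) h) g.
Implicit Types (a b c x y : G -> G) (h g : H).

Local Notation Aelt := {a : G -> G | A a}.
Local Notation L := (l2 I H).

Let SB a : A a -> B (S a). Proof. by case: ucpS => SB _ _ _ _; exact: SB. Qed.
Let Slin : linear_on A S. Proof. by case: ucpS. Qed.
Let Amul a b : A a -> A b -> A (a \o b). Proof. exact: vna_comp vA _ _. Qed.
Let Abd a : A a -> bounded_map a. Proof. exact: vna_bounded_map. Qed.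

Let AD a b : A a -> A b -> A (a - b).
Proof. by move=> Aa Ab; rewrite -scaleN1r addrC; exact: vna_linear vA _ _ _ Ab Aa. Qed.

Let w_lin a z h g : A a -> w a (z *: h + g) = z *: w a h + w a g.
Proof.
move=> Aa; apply: l2_ext => i; rewrite l2_add l2_scale.
by have [lw _] := vna_bounded_map vB (wB i Aa); exact: lw.
Qed.

Let wZ a z h : A a -> w a (z *: h) = z *: w a h.
Proof. by move=> Aa; apply: (linZ (f := w a)) => k u v; exact: w_lin. Qed.

(** Linearity in the algebra variable follows from the inner products alone: the
    defect is orthogonal to all [w c g], and lies in their span. *)
Let w_op_lin a b z h : A a -> A b -> w (z *: a + b) h = z *: w a h + w b h.
Proof.
move=> Aa Ab; have Ac : A (z *: a + b) by exact: (vna_linear vA).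
pose d := w (z *: a + b) h - (z *: w a h + w b h).
have d0 c g : A c -> dotp d (w c g) = 0.
  move=> Acc; have [c' Ac' cc'] := vna_adjoint_ex vA Acc.
  rewrite /d dotBl dotDl dotZl !(wG _ _ _ Acc Ac' cc') //.
  rewrite (_ : c' \o (z *: a + b) = z *: (c' \o a) + (c' \o b)).
    have [Aca Acb] := (Amul Ac' Aa, Amul Ac' Ab).
    by rewrite Slin // fun_addE fun_scaleE dotDl dotZl subrr.
  by apply/funext => u; rewrite /= !(fun_addE, fun_scaleE) (proj1 (Abd Ac')).
apply/eqP; rewrite -subr_eq0 -/d; apply/eqP/nrm0_eq0/eqP.
by rewrite -sqrf_eq0 nrm_sqr {2}/d dotBr dotDr dotZr !d0 // mulr0 addr0 subrr.
Qed.

Let w_zero h : w 0 h = 0.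
Proof.
have A0 := vna_zero vA; have := w_op_lin (-1) h A0 A0.
by rewrite scaler0 addr0 scaleN1r addNr.
Qed.

Let AZ z a : A a -> A (z *: a).
Proof. by move=> Aa; rewrite -[_ *: _]addr0; exact: (vna_linear vA) Aa (vna_zero vA). Qed.

Let w_opZ z a h : A a -> w (z *: a) h = z *: w a h.
Proof.
move=> Aa; have := w_op_lin z h Aa (vna_zero vA).
by rewrite !addr0 w_zero addr0.
Qed.

Let s (p : Aelt * H) : L := w (sval p.1) p.2.
Let t c (p : Aelt * H) : L := w (c \o sval p.1) p.2.

Let S_positive n (x : 'I_n -> 'I_n -> G -> G) (u : 'I_n -> H) :
  (forall i j, A (x i j)) -> positive_mx x ->
  0 <= \sum_(i < n) \sum_(j < n) dotp (S (x i j) (u j)) (u i).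
Proof. by case: ucpS => _ _ cp _ _ Ax px; exact: cp. Qed.

(** The matrix [a_i^* c a_j] is positive when [c] is, and complete positivity
    hands this over to [S]. *)
Let compress_positive c : A c -> positive_op c ->
  forall n (a : 'I_n -> G -> G) (u : 'I_n -> H), (forall i, A (a i)) ->
  0 <= \sum_(i < n) \sum_(j < n) dotp (w (c \o a j) (u j)) (w (a i) (u i)).
Proof.
move=> Ac pc n a u Aa.
have /choice[a' a'P] : forall i, exists a', A a' /\ is_adjoint (a i) a'.
  by move=> i; have [a' ? ?] := vna_adjoint_ex vA (Aa i); exists a'.
rewrite (eq_bigr (fun i => \sum_(j < n) dotp (S (a' i \o (c \o a j)) (u j)) (u i))).
  apply: S_positive => [i j|v].
    by apply: Amul; [case: (a'P i) | exact: Amul].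
  rewrite (_ : \sum_(i < n) _ = dotp (c (\sum_(j < n) a j (v j))) (\sum_(i < n) a i (v i))).
    exact: pc.
  rewrite (lin_sum (proj1 (Abd Ac))) dot_sumr; apply: eq_bigr => i _.
  rewrite dot_suml; apply: eq_bigr => j _ /=.
  by rewrite (is_adjoint_sym (a'P i).2).
move=> i _; apply: eq_bigr => j _; have Acj := Amul Ac (Aa j).
by rewrite (wG _ _ Acj (Aa i) (a'P i).1 (a'P i).2).
Qed.

Let sumE c (l : seq (C * (Aelt * H))) : A c ->
  \sum_(p <- l) p.1 *: t c p.2 = \sum_(p <- l) w (c \o sval p.2.1) (p.1 *: p.2.2).
Proof.
move=> Ac; apply: eq_bigr => p _; rewrite /t wZ //.
by apply: Amul => //; exact: svalP.
Qed.

Let sum1E (l : seq (C * (Aelt * H))) :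
  \sum_(p <- l) p.1 *: s p.2 = \sum_(p <- l) w (sval p.2.1) (p.1 *: p.2.2).
Proof. exact: (sumE l (vna_id vA)). Qed.

Let positive_sum c (l : seq (C * (Aelt * H))) : A c -> positive_op c ->
  0 <= dotp (\sum_(p <- l) p.1 *: t c p.2) (\sum_(p <- l) p.1 *: s p.2).
Proof.
move=> Ac pc; rewrite sumE // sum1E dot_sumr (big_tnth _ _ l).
under eq_bigr do rewrite dot_suml big_tnth.
apply: (compress_positive Ac pc (a := fun i => sval (tnth (in_tuple l) i).2.1)
  (fun i => (tnth (in_tuple l) i).1 *: (tnth (in_tuple l) i).2.2)) => i.
exact: svalP.
Qed.

Let t_dot c b (l m : seq (C * (Aelt * H))) : A c -> A b -> is_adjoint c b ->
  dotp (\sum_(p <- l) p.1 *: t c p.2) (\sum_(p <- m) p.1 *: s p.2) =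
  dotp (\sum_(p <- l) p.1 *: s p.2) (\sum_(p <- m) p.1 *: t b p.2).
Proof.
move=> Ac Ab cb; rewrite !sumE // !sum1E !dot_suml; apply: eq_bigr => p _.
rewrite !dot_sumr; apply: eq_bigr => q _.
have [q' Aq' qq'] := vna_adjoint_ex vA (svalP q.2.1).
have Ap := svalP p.2.1; have Aq := svalP q.2.1.
rewrite (wG _ _ (Amul Ac Ap) Aq Aq' qq').
rewrite (wG _ _ Ap (Amul Ab Aq) (Amul Aq' Ac)) //.
by move=> u v /=; rewrite (is_adjoint_sym cb) qq'.
Qed.

(** Apply positivity to [M^2 - c^* c] with [M] a bound of [c]. *)
Let t_bound c : A c -> exists2 M, 0 <= M & forall l : seq (C * (Aelt * H)),
  nrm (\sum_(p <- l) p.1 *: t c p.2) <= M * nrm (\sum_(p <- l) p.1 *: s p.2).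
Proof.
move=> Ac; have [lc [M M0 cM]] := Abd Ac; exists M => // l.
have [b Ab cb] := vna_adjoint_ex vA Ac; have Abc := Amul Ab Ac.
pose e : G -> G := (M ^+ 2)%:C *: idfun - (b \o c).
have Ae : A e.
  by apply: AD => //; apply: AZ; exact: vna_id.
have pe : positive_op e.
  move=> u; rewrite /e fun_addE fun_oppE fun_scaleE dotBl dotZl /=.
  rewrite (is_adjoint_sym cb) !dot_nrm -rmorphM subr_ge0 lecR -exprMn.
  by rewrite ler_pXn2r ?nnegrE ?nrm_ge0 ?mulr_ge0 ?nrm_ge0.
have := positive_sum l Ae pe.
have -> : \sum_(p <- l) p.1 *: t e p.2 = (M ^+ 2)%:C *: \sum_(p <- l) p.1 *: s p.2 -
    \sum_(p <- l) p.1 *: t (b \o c) p.2.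
  rewrite scaler_sumr -sumrB; apply: eq_bigr => p _.
  have Ap := svalP p.2.1; rewrite scalerA [_ * p.1]mulrC -scalerA -scalerBr; congr (_ *: _).
  rewrite /t (_ : e \o sval p.2.1 =
    (M ^+ 2)%:C *: sval p.2.1 + (-1) *: ((b \o c) \o sval p.2.1)).
    have Abcp := Amul Abc Ap.
    rewrite w_op_lin ?w_opZ //; first by rewrite scaleN1r.
    exact: AZ.
  by apply/funext => u; rewrite /e scaleN1r.
rewrite dotBl dotZl subr_ge0.
rewrite (_ : \sum_(p <- l) p.1 *: t (b \o c) p.2 =
    \sum_(p <- [seq (q.1, (exist _ _ (Amul Ac (svalP q.2.1)), q.2.2)) | q <- l])
      p.1 *: t b p.2); last by rewrite big_map.
rewrite (t_dot _ _ Ab Ac (is_adjoint_sym cb)) big_map /=.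
rewrite -[\sum_(i <- l) _]/(\sum_(p <- l) p.1 *: t c p.2) !dot_nrm -rmorphM lecR -exprMn.
by rewrite ler_pXn2r ?nnegrE ?nrm_ge0 ?mulr_ge0 ?nrm_ge0.
Qed.

Let W := range s.
Let cW : closed_subspace (closed_span W) := closed_span_closed W.

Let J_ex c : exists f : L -> L, A c ->
  [/\ bounded_map f, forall p, f (s p) = t c p,
      forall u, (forall p, dotp (s p) u = 0) -> f u = 0 &
      forall u, closed_span W (f u)].
Proof.
have [Ac|nAc] := pselect (A c); last by exists 0.
have [M M0 tM] := t_bound Ac.
have [f [bf fs f0 fN]] := bounded_extension M0 tM.
exists f => _; split=> // u; apply: fN => // p; apply: sub_closed_span.
by exists (exist _ _ (Amul Ac (svalP p.1)), p.2).
Qed.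

Let J c : L -> L := sval (cid (J_ex c)).

Let J_bounded c : A c -> bounded_map (J c).
Proof. by rewrite /J; case: cid => f /= + Ac => /(_ Ac)[]. Qed.

Let J_w c a h : A c -> A a -> J c (w a h) = w (c \o a) h.
Proof.
move=> Ac Aa; rewrite /J; case: cid => f /= /(_ Ac)[_ fs _ _].
exact: (fs (exist _ a Aa, h)).
Qed.

Let J_perp c u : A c -> (forall a h, A a -> dotp (w a h) u = 0) -> J c u = 0.
Proof.
move=> Ac hu; rewrite /J; case: cid => f /= /(_ Ac)[_ _ f0 _].
by apply: f0 => p; apply: hu; exact: svalP.
Qed.

Let J_span c u : A c -> closed_span W (J c u).
Proof. by move=> Ac; rewrite /J; case: cid => f /= /(_ Ac)[_ _ _]. Qed.

Let w_ind (P : set L) : closed_subspace P -> (forall a h, A a -> P (w a h)) ->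
  (forall u, (forall a h, A a -> dotp (w a h) u = 0) -> P u) -> forall u, P u.
Proof.
move=> cP Pw Pp; apply: (total_ind (S := W)) => // [_ [p _ <-]|u hu].
  by apply: Pw; exact: svalP.
by apply: Pp => a h Aa; apply: hu; exists (exist _ a Aa, h).
Qed.

Let eq_w (f1 f2 : L -> L) : bounded_map f1 -> bounded_map f2 ->
  (forall a h, A a -> f1 (w a h) = f2 (w a h)) ->
  (forall u, (forall a h, A a -> dotp (w a h) u = 0) -> f1 u = f2 u) -> f1 = f2.
Proof.
move=> bf bg fg1 fg2; apply/funext; exact: w_ind (eq_closed bf bg) fg1 fg2.
Qed.

Let J_lin : linear_on A J.
Proof.
move=> z x y Ax Ay; have Axy : A (z *: x + y) by exact: (vna_linear vA).
have [bx by_] := (J_bounded Ax, J_bounded Ay).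
apply: eq_w => [||a h Aa|u hu].
- exact: J_bounded.
- exact: bounded_map_lin.
- rewrite fun_addE fun_scaleE !J_w //.
  rewrite (_ : (z *: x + y) \o a = z *: (x \o a) + (y \o a)) //.
  by rewrite w_op_lin //; exact: Amul.
- by rewrite fun_addE fun_scaleE !J_perp // scaler0 addr0.
Qed.

Let J_comp x y : A x -> A y -> J (x \o y) = J x \o J y.
Proof.
move=> Ax Ay; have Axy := Amul Ax Ay.
have [bx by_] := (J_bounded Ax, J_bounded Ay).
apply: eq_w => [||a h Aa|u hu].
- exact: J_bounded.
- exact: bounded_map_comp.
- by rewrite /= !J_w //; exact: Amul.
- by rewrite /= (J_perp Axy hu) (J_perp Ay hu) (lin0 (proj1 bx)).
Qed.

Let J_adjoint x y : A x -> A y -> is_adjoint x y -> is_adjoint (J x) (J y).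
Proof.
move=> Ax Ay xy; have [bx by_] := (J_bounded Ax, J_bounded Ay).
have [z bz xz] := adjoint_ex bx.
suff -> : J y = z by exact: xz.
apply: eq_w => // [b g Ab|u hu]; apply: dot_inj.
  move=> u; apply/eqP; rewrite -subr_eq0 -dotBr; apply/eqP.
  set d := _ - _; suff : dotp d u = 0 by move=> du; rewrite dotC du conjC0.
  move: u; apply: w_ind => [|a h Aa|u hu].
  - have := @perp_closed _ _ [set d]; rewrite (_ : [set u | _] = [set u | dotp d u = 0]) //.
    by apply/seteqP; split=> u /= du; [exact: du|move=> _ ->].
  - rewrite /= dotC; apply/eqP; rewrite conjC_eq0 /d dotBr -xz !J_w // subr_eq0.
    have [b' Ab' bb'] := vna_adjoint_ex vA Ab.
    rewrite (wG _ _ (Amul Ax Aa) Ab Ab' bb').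
    rewrite (wG _ _ Aa (Amul Ay Ab) (Amul Ab' Ax)) // => v v' /=.
    by rewrite (is_adjoint_sym xy) bb'.
  rewrite /= dotC; apply/eqP; rewrite conjC_eq0 /d dotBr -xz (J_perp Ax hu) dot0l subr0.
  by rewrite dotC J_w // hu ?conjC0 //; exact: Amul.
move=> v; rewrite J_perp // dot0r -xz.
apply/esym; apply: (closed_span_perp (S := W)); last exact: J_span.
by move=> _ [p _ <-]; apply: hu; exact: svalP.
Qed.

(** [J c] commutes with [y (x) 1] for every [y] in the commutant of [B], because
    [y (x) 1] maps [w a h] to [w a (y h)] and preserves the orthogonal complement
    of these vectors. *)
Let J_entry c i j : A c -> B (entry (J c) i j).
Proof.
move=> Ac; have bJ := J_bounded Ac.
apply: (bicommutant vB (entry_bounded i j bJ)) => y yc u.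
case: (yc) => by_ ycB; have bY := amplify_bounded I by_.
have [z bz yz] := adjoint_ex by_; have [_ zcB] := commutant_adjoint vB yc bz yz.
have Yw (k : H -> H) : commutant B k ->
    forall a h, A a -> amplify k (w a h) = w a (k h).
  move=> [bk kcB] a h Aa; apply: l2_ext => n; rewrite amplifyE //.
  exact: kcB (wB n Aa) h.
have zc : commutant B z by [].
have Yperp v : (forall a h, A a -> dotp (w a h) v = 0) ->
    forall a h, A a -> dotp (w a h) (amplify y v) = 0.
  move=> hv a h Aa; rewrite -(amplify_adjoint bz by_ (is_adjoint_sym yz)) Yw //.
  exact: hv.
have comm : J c \o amplify y = amplify y \o J c.
  apply: eq_w => [||a h Aa|v hv].
  - exact: bounded_map_comp.
  - exact: bounded_map_comp.
  - by rewrite /= Yw // !J_w // Yw //; exact: Amul.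
  - rewrite /= J_perp //; last exact: Yperp.
    by rewrite J_perp // (lin0 (proj1 bY)).
by rewrite /entry -(amplify_single _ _ by_) -[LHS]/((J c \o amplify y) _ _) comm /= amplifyE.
Qed.

(** Finite combinations of the [w a h] are not a closed subspace and the form
    of [J p] is quadratic, so here positivity is passed to the limit by hand. *)
Let J_positive p : A p -> positive_op p -> positive_op (J p).
Proof.
move=> Ap pp u; have bJ := J_bounded Ap; have [lJ [M M0 JM]] := bJ.
pose u1 := orth_proj cW u.
have -> : dotp (J p u) u = dotp (J p u1) u1.
  have u2 v : closed_span W v -> dotp v (u - u1) = 0 by exact: orth_proj_perp.
  rewrite -{1}[u](subrK u1) (linD lJ) (J_perp Ap) => [|a h Aa]; last first.
    by apply: u2; apply: sub_closed_span; exists (exist _ a Aa, h).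
  rewrite add0r; apply/eqP; rewrite -subr_eq0 -dotBr; apply/eqP.
  by apply: u2; exact: J_span.
have u1W : closed_span W u1 by exact: orth_projM.
apply: ge0_approx => e e0.
(* [k] bounds the change of the form per unit of distance, within [1] of [u1]. *)
pose k := 2 * M * nrm u1 + M.
have k0 : 0 <= k by rewrite addr_ge0 // !mulr_ge0 // nrm_ge0.
have [d' d'0 d'e] := eps_div k0 e0.
pose d := Num.min 1 d'.
have d0 : 0 < d by rewrite lt_min ltr01.
have d1 : d <= 1 by rewrite ge_min lexx.
have dd' : d <= d' by rewrite ge_min lexx orbT.
have [l ul] := closed_span_approx u1W d0.
exists (dotp (\sum_(q <- l) q.1 *: t p q.2) (\sum_(q <- l) q.1 *: s q.2)).
  exact: positive_sum.
set v := \sum_(q <- l) _ *: s _ in ul *.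
have -> : \sum_(q <- l) q.1 *: t p q.2 = J p v.
  rewrite (lin_sum lJ); apply: eq_bigr => q _; rewrite (linZ lJ) J_w //.
  exact: svalP.
have -> : dotp (J p u1) u1 - dotp (J p v) v =
    dotp (J p (u1 - v)) u1 + dotp (J p v) (u1 - v).
  by rewrite (linB lJ) dotBl dotBr; ring.
apply: le_trans (cabsD _ _) _.
have h1 := dot_le (J p (u1 - v)) u1; have h2 := dot_le (J p v) (u1 - v).
have h3 := JM (u1 - v); have h4 := JM v.
have h5 : nrm v <= nrm u1 + d.
  by rewrite -[v](subrK u1) addrC (le_trans (nrmD _ _)) // lerD2l nrmBC.
have n1 := nrm_ge0 u1; have n2 := nrm_ge0 (u1 - v); have n3 := nrm_ge0 v.
have h6 : nrm (J p (u1 - v)) * nrm u1 <= M * d * nrm u1.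
  by rewrite ler_wpM2r // (le_trans h3) // ler_wpM2l.
have h7 : nrm (J p v) * nrm (u1 - v) <= M * (nrm u1 + 1) * d.
  apply: ler_pM; rewrite ?nrm_ge0 //; apply: le_trans h4 _.
  by rewrite ler_wpM2l // (le_trans h5) // lerD2l.
have : k * d <= e by rewrite -d'e; apply: le_trans (ler_wpM2l k0 dd') _; nra.
rewrite /k; lra.
Qed.

Let SBpos x : A x -> positive_op x -> positive_op (S x).
Proof.
move=> Ax px h; have := @S_positive 1 (fun _ _ => x) (fun=> h) (fun _ _ => Ax).
by rewrite !big_ord1; apply=> u; rewrite !big_ord1.
Qed.

Let S_le x y : A x -> A y -> op_le x y -> op_le (S x) (S y).
Proof.
move=> Ax Ay xy; rewrite /op_le.
have := Slin (-1) Ax Ay; rewrite !scaleN1r [in LHS]addrC [RHS]addrC => <-.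
by apply: SBpos => //; exact: AD.
Qed.

Let S_selfadjoint x : A x -> selfadjoint x -> selfadjoint (S x).
Proof.
move=> Ax sx h g; have A1 : A idfun := vna_id vA.
have id1 : is_adjoint (idfun : G -> G) idfun by [].
have h1 : dotp (w x h) (w idfun g) = dotp (S x h) g by exact: (wG h g Ax A1 A1 id1).
have h2 : dotp (w x g) (w idfun h) = dotp (S x g) h by exact: (wG g h Ax A1 A1 id1).
rewrite -h1 [RHS]dotC -h2 -dotC h1; apply/esym; exact: (wG h g A1 Ax Ax sx).
Qed.

Let J_le x y : A x -> A y -> op_le x y -> op_le (J x) (J y).
Proof.
move=> Ax Ay xy; rewrite /op_le.
have := J_lin (-1) Ax Ay; rewrite !scaleN1r [in LHS]addrC [RHS]addrC => <-.
by apply: J_positive => //; exact: AD.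
Qed.

(** The compressions [a^* d a] of a directed set form a directed set whose
    supremum is the compression of the supremum, so that normality of [S]
    applies to them. *)
Let S_compress_sup (D : set (G -> G)) x a h : D `<=` A `&` selfadjoint ->
  directed op_le D -> weak_sup D x -> A x -> A a -> forall e, 0 < e ->
  exists2 d, D d & complex.Re (dotp (w (x \o a) h) (w a h)) -
    complex.Re (dotp (w (d \o a) h) (w a h)) <= e.
Proof.
move=> DA [[d0 Dd0] dirD] [xub xsup] Ax Aa e e0.
have [b Ab ab] := vna_adjoint_ex vA Aa.
pose k d := b \o (d \o a).
have Ak d : A d -> A (k d) by move=> Ad; apply: Amul => //; exact: Amul.
have kE d u : dotp (k d u) u = dotp (d (a u)) (a u) by rewrite /k /= (is_adjoint_sym ab).
have k_le d d' : op_le d d' -> op_le (k d) (k d').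
  move=> dd' u; rewrite fun_addE fun_oppE dotBl !kE -dotBl; exact: dd'.
have kD : k @` D `<=` A `&` selfadjoint.
  move=> _ [d /DA[Ad sd] <-]; split; first exact: Ak.
  by move=> u v; rewrite /k /= (is_adjoint_sym ab) sd -ab.
have kdir : directed op_le (k @` D).
  split; first by exists (k d0), d0.
  move=> _ _ [d Dd <-] [d' Dd' <-]; have [f [Df df d'f]] := dirD _ _ Dd Dd'.
  by exists (k f); split; [exists f|exact: k_le|exact: k_le].
have klub : lub_in op_le A (k @` D) (k x).
  apply: weak_sup_lub; [exact: Ak|by case: kdir|].
  split=> [_ [d Dd <-]|u c c0]; first exact/k_le/xub.
  have [d Dd xd] := xsup (a u) c c0; exists (k d); first by exists d.
  by rewrite /qform !kE.
case: ucpS => _ _ _ _ /(_ _ _ kD kdir klub) Slub.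
have [_ /(_ h e e0)[_ [_ [d Dd <-] <-]]] : weak_sup (S @` (k @` D)) (S (k x)).
  apply: (lub_weak_sup (vna_bounded vB) _ _ _ Slub).
  - by rewrite (vna_closed vB).
  - move=> _ [y /kD[Ay sy] <-]; split; [exact: SB | exact: S_selfadjoint].
  - split; first by exists (S (k d0)), (k d0) => //; exists d0.
    move=> _ _ [y yD <-] [y' yD' <-].
    have [f [fD yf y'f]] := kdir.2 _ _ yD yD'.
    have [Ay _] := kD _ yD; have [Ay' _] := kD _ yD'; have [Af _] := kD _ fD.
    by exists (S f); split; [exists f|exact: S_le|exact: S_le].
move=> Sd; exists d => //; have [Ad _] := DA _ Dd.
by rewrite (wG h h (Amul Ax Aa) Aa Ab ab) (wG h h (Amul Ad Aa) Aa Ab ab).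
Qed.

Local Notation N := (vn_tensor (T := l2_tensor I H) B bounded_op).

Let J_range c : A c -> N (J c).
Proof. by move=> Ac; apply: entries_vn_tensor => [|i j]; [exact: J_bounded|exact: J_entry]. Qed.

Let J_normal : normal_on A (op_le : (L -> L) -> _) N J.
Proof.
move=> D x DA dirD xlub; have Ax : A x by case: xlub.
have wx : weak_sup D x.
  apply: lub_weak_sup DA dirD xlub; first exact: vna_bounded.
  by rewrite (vna_closed vA).
have Jle d : D d -> op_le (J d) (J x).
  by move=> Dd; have [Ad _] := DA _ Dd; apply: J_le => //; exact: wx.1.
apply: weak_sup_lub; first exact: J_range.
  by case: dirD => [[d Dd] _]; exists (J d), d.
split=> [_ [d Dd <-]|]; first exact: Jle.
apply: w_ind => [|a h Aa|u hu].
- apply: weak_sup_closed; first exact: J_bounded.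
  + by move=> _ [d /DA[Ad _] <-]; exact: J_bounded.
  + split; first by case: dirD => [[d Dd] _]; exists (J d), d.
    move=> _ _ [d Dd <-] [d' Dd' <-]; have [f [Df df d'f]] := dirD.2 _ _ Dd Dd'.
    have [[Ad _] [Ad' _] [Af _]] := And3 (DA _ Dd) (DA _ Dd') (DA _ Df).
    by exists (J f); split; [exists f|exact: J_le|exact: J_le].
  + by move=> _ [d Dd <-]; exact: Jle.
- move=> e e0; have [d Dd hd] := S_compress_sup h DA dirD wx Ax Aa e0.
  exists (J d); first by exists d.
  by have [Ad _] := DA _ Dd; rewrite /qform !J_w.
move=> e e0; case: dirD => [[d Dd] _]; exists (J d); first by exists d.
by have [Ad _] := DA _ Dd; rewrite /qform !J_perp // dot0l subrr ltW.
Qed.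

(** The component at [i0] of [w 1 h] is [S 1 h = h], which already exhausts its
    norm. *)
Let w_id h : w idfun h = single i0 h.
Proof.
have A1 : A idfun := vna_id vA; have id1 : is_adjoint (idfun : G -> G) idfun by [].
have S1 : S idfun = idfun by case: ucpS.
apply/eqP; rewrite -subr_eq0; apply/eqP/nrm0_eq0/eqP; rewrite -sqrf_eq0 nrm_sqr.
rewrite dotBl !dotBr (wG h h A1 A1 A1 id1) -[idfun \o idfun]/(idfun : G -> G) S1.
rewrite !dot_single dot_single_r w0 // S1 singleE eqxx.
by rewrite !subrr.
Qed.

Lemma dilation_exists : exists j : (G -> G) -> (l2_tensor I H -> l2_tensor I H),
  weak_tensor_dilation A B bounded_op
    (vector_state (unit_vec i0 : l2 I (cline R))) S j.
Proof.
exists J; split.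
- split.
  + exact: J_range.
  + exact: J_lin.
  + exact: J_comp.
  + exact: J_adjoint.
  + exact: J_normal.
- by apply: vector_state_normal; exact: nrm_unit_vec.
exists (fun z : L -> L => entry z i0 i0); split; first exact: slice_expectation.
move=> a Aa; apply/funext => h.
have A1 := vna_id vA; rewrite /entry -w_id (J_w h Aa A1).
by rewrite -[LHS]/(S (a \o idfun) h) -w0 //; exact: Amul.
Qed.

End Dilation.

Theorem theorem1p4 (R : realType) (G H : hilbertType R)
    (A : set (G -> G)) (B : set (H -> H)) (S : (G -> G) -> (H -> H)) :
  von_neumann_algebra A -> von_neumann_algebra B -> normal_ucp A B S ->
  exists (K : hilbertType R) (k0 : K) (T : hilbert_tensor H K)
      (j : (G -> G) -> (T -> T)),
    `|k0| = 1 /\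
    weak_tensor_dilation A B (bounded_op : set (K -> K)) (vector_state k0) S j.
Proof.
move=> vA vB ucpS.
have [I [i0 [w [wB w0 wG]]]] := kolmogorov_decomposition vA vB ucpS.
have [j jP] := dilation_exists vA vB ucpS wB w0 wG.
exists (l2 I (cline R)), (unit_vec i0), (l2_tensor I H), j; split=> //.
exact: nrm_unit_vec.
Qed.
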